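(* Let $\mu$ be a finite positive Borel measure supported on the closed unit disk $\overline{\mathbb{D}}$ and let $\Delta_{M_z}=M_z^*M_z-I$ be the defect operator of the operator $M_z$ of multiplication by $z$ on the Dirichlet space $D(\mu)$. Let $k$ be a positive integer. Then the following are equivalent: (i) $\Delta_{M_z}$ is of rank $k$. (ii) There exist constants $c_i>0$, $1\le i\le k$, and $\zeta_i\in\overline{\mathbb{D}}$, $1\le i\le k$, such that $\mu=\sum_{i=1}^k c_i\delta_{\zeta_i}$.
   Context: $\mathbb{D}$ is the open unit disk in $\mathbb{C}$, $\mathbb{T}$ the unit circle, and $H^2$ the Hardy space of analytic functions on $\mathbb{D}$ with square-summable Taylor coefficients (with its usual norm $\|\cdot\|_{H^2}$). $\delta_\zeta$ is the unit point mass at $\zeta$. Local Dirichlet integral: for $\zeta\in\mathbb{D}$ and $f\in H^2$, $D_\zeta(f)=\left\|\frac{f-f(\zeta)}{z-\zeta}\right\|_{H^2}^2$. For $\zeta\in\mathbb{T}$, $D_\zeta(f)=\left\|\frac{f-f(\zeta)}{z-\zeta}\right\|_{H^2}^2$ if the nontangential limit $f(\zeta)$ of $f$ at $\zeta$ exists (with value $\infty$ if the quotient is not in $H^2$), and $D_\zeta(f)=\infty$ otherwise. Dirichlet-type space: for a finite nonnegative Borel measure $\mu$ supported on $\overline{\mathbb{D}}$, $D(\mu)$ is the space of those $f\in H^2$ with $\int D_\zeta(f)\,d\mu(\zeta)<\infty$, a reproducing kernel Hilbert space with norm given by $\|f\|^2=\|f\|_{H^2}^2+\int D_\zeta(f)\,d\mu(\zeta)$.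 The operator $M_z$ is bounded on $D(\mu)$, and the adjoint $M_z^*$ is taken with respect to the inner product of $D(\mu)$.
   Formalization: In (ii) the points ζ_i are required to be pairwise distinct; without this (ii) does not imply (i), e.g. for k = 2 the measure δ_0 + δ_0 = 2δ_0 gives a defect operator of rank 1. *)

(* Defs.v *)
From HB Require Import structures.
From mathcomp Require Import all_boot all_order all_algebra.
From mathcomp Require Import complex.
From mathcomp Require Import all_classical all_reals all_analysis.

Set Implicit Arguments.
Unset Strict Implicit.
Unset Printing Implicit Defensive.

Import Order.TTheory GRing.Theory Num.Theory.
Import numFieldNormedType.Exports.

Local Open Scope classical_set_scope.
Local Open Scope complex_scope.
Local Open Scope ring_scope.

(* [R[i]^o] rather than [R[i]]: only the former carries the canonical normed
   (hence topological) structure. *)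
Notation Cplx R := ((R[i])^o).

Definition borelC (R : realType) := g_sigma_algebraType (@open (Cplx R)).

(* Real-valued modulus; the norm [`|z|] of [R[i]] takes its values in [R[i]]. *)
Definition modulus (R : realType) (z : Cplx R) : R := ComplexField.Normc.normc z.

Definition disk (R : realType) : set (Cplx R) := [set z | modulus z < 1].

Definition closed_disk (R : realType) : set (Cplx R) := [set z | modulus z <= 1].

(* A function on the open disk is represented by its extension by 0 to the
   whole plane, so that equality of representatives is equality on the disk. *)
Definition power_series_on_disk (R : realType) (f : Cplx R -> Cplx R)
    (a : nat -> Cplx R) : Prop :=
  (forall z, disk z -> series (fun n => a n * z ^+ n) @ \oo --> f z) /\
  (forall z, ~ disk z -> f z = 0).

(* The infimum is over at most one value, Taylor coefficients being unique; it
   is +oo when [f] is not analytic on the disk. *)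
Definition h2_norm2 (R : realType) (f : Cplx R -> Cplx R) : \bar R :=
  ereal_inf [set (\sum_(0 <= n <oo) (modulus (a n) ^+ 2)%:E)%E
            | a in power_series_on_disk f].

Definition hardy (R : realType) : set (Cplx R -> Cplx R) :=
  [set f | (h2_norm2 f < +oo)%E].

(* [g] is (f - w) / (z - zeta); continuity of [g] settles its value at [zeta]
   when [zeta] is in the disk. *)
Definition difference_quotient (R : realType) (f : Cplx R -> Cplx R)
    (zeta w : Cplx R) (g : Cplx R -> Cplx R) : Prop :=
  forall z, disk z -> z != zeta -> g z = (f z - w) / (z - zeta).

(* Again an infimum over at most one finite value, and +oo when no difference
   quotient lies in H^2. *)
Definition difference_quotient_norm2 (R : realType) (f : Cplx R -> Cplx R)
    (zeta w : Cplx R) : \bar R :=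
  ereal_inf [set h2_norm2 g | g in difference_quotient f zeta w].

Definition stolz_region (R : realType) (zeta : Cplx R) (M : R) : set (Cplx R) :=
  [set z | disk z /\ modulus (z - zeta) < M * (1 - modulus z)].

Definition nontangential_limit (R : realType) (f : Cplx R -> Cplx R)
    (zeta w : Cplx R) : Prop :=
  forall M : R, 1 < M -> f @ within (stolz_region zeta M) (nbhs zeta) --> w.

(* On the circle the infimum is over the nontangential limits of [f] at
   [zeta]: at most one value, and +oo if there is none. *)
Definition local_dirichlet (R : realType) (f : Cplx R -> Cplx R)
    (zeta : Cplx R) : \bar R :=
  if modulus zeta < 1 then difference_quotient_norm2 f zeta (f zeta)
  else ereal_inf [set difference_quotient_norm2 f zeta w
                 | w in nontangential_limit f zeta].

Section DirichletSpace.
Variables (R : realType) (mu : {measure set (borelC R) -> \bar R}).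
Implicit Types (f g : Cplx R -> Cplx R).

Definition dirichlet_integral f : \bar R :=
  (\int[mu]_(zeta in closed_disk (R := R)) local_dirichlet f zeta)%E.

Definition dirichlet_space : set (Cplx R -> Cplx R) :=
  [set f | hardy f /\ (dirichlet_integral f < +oo)%E].

Definition dirichlet_norm2 f : R := fine (h2_norm2 f + dirichlet_integral f)%E.

(* The inner product of the norm, by polarization; linear in the first
   argument. *)
Definition dirichlet_inner f g : R[i] :=
  4^-1 * \sum_(j < 4)
    'i ^+ j * (dirichlet_norm2 (fun z => f z + 'i ^+ j * g z))%:C.

Definition is_adjoint (T S : (Cplx R -> Cplx R) -> (Cplx R -> Cplx R)) : Prop :=
  (forall f, dirichlet_space f -> dirichlet_space (S f)) /\
  (forall f g, dirichlet_space f -> dirichlet_space g ->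
     dirichlet_inner (T f) g = dirichlet_inner f (S g)).

(* Only the restriction of the adjoint to [dirichlet_space] is meaningful; the
   value 0 is a default for operators without an adjoint. *)
Definition adjoint (T : (Cplx R -> Cplx R) -> (Cplx R -> Cplx R)) :
    (Cplx R -> Cplx R) -> (Cplx R -> Cplx R) :=
  xget (fun _ _ => 0) [set S | is_adjoint T S].

Definition Mz f : Cplx R -> Cplx R := fun z => z * f z.

Definition defect f : Cplx R -> Cplx R :=
  fun z => adjoint Mz (Mz f) z - f z.

End DirichletSpace.

Definition lin_comb (R : realType) (k : nat) (e : 'I_k -> Cplx R -> Cplx R)
    (c : 'I_k -> Cplx R) : Cplx R -> Cplx R :=
  fun z => \sum_(i < k) c i * e i z.

Definition has_dim (R : realType) (V : set (Cplx R -> Cplx R)) (k : nat) : Prop :=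
  exists e : 'I_k -> Cplx R -> Cplx R,
    (forall c, lin_comb e c = (fun=> 0) -> forall i, c i = 0) /\
    V = range (lin_comb e).

Definition has_rank (R : realType) (V : set (Cplx R -> Cplx R))
    (T : (Cplx R -> Cplx R) -> (Cplx R -> Cplx R)) (k : nat) : Prop :=
  has_dim (T @` V) k.

(* Main.v *)
(* For f in D(mu) with Taylor coefficients a, and zeta in the closed disk,
   D_zeta(f) is the squared norm of the unique square-summable solution b of
   b_n - zeta b_(n+1) = a_(n+1), and is infinite if there is none; the value
   of f at zeta is then a_0 + zeta b_0. Passing from f to z f shifts b and
   prepends that value, so D_zeta(z f) = D_zeta(f) + |f(zeta)|^2, and the
   defect operator represents the form (f, g) |-> int f conj(g) dmu.

   If the defect has rank k, some nonzero polynomial p of degree at most k is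
   killed by it, so int |p|^2 dmu = 0 and mu lives on the zeros of p.
   Conversely, for m atoms zeta_i of masses c_i, the defect sends f to
   sum_i f(zeta_i) e_i, where e_i / c_i is the reproducing kernel at zeta_i;
   Lagrange interpolation shows that the e_i are independent and all reached,
   so that the rank is exactly m. *)
Require Import Defs.
From HB Require Import structures.
From mathcomp Require Import all_boot all_order all_algebra.
From mathcomp Require Import complex.
From mathcomp Require Import all_classical all_reals all_analysis.
From mathcomp Require Import measurable_realfun ring lra.

Set Implicit Arguments.
Unset Strict Implicit.
Unset Printing Implicit Defensive.

Import Order.TTheory GRing.Theory Num.Theory.
Import numFieldNormedType.Exports.

Local Open Scope classical_set_scope.
Local Open Scope ring_scope.

(** * The modulus *)

Section Modulus.
Variable R : realType.
Implicit Types (z w : Cplx R) (t : R).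

(** The inner product is given only by polarization, so its sesquilinearity has to be won back from
    the parallelogram law, as in the theorem of Jordan and von Neumann. That law is carried from the
    local integrals to D(mu) by additivity of the integral, which calls for the measurability of
    zeta |-> D_zeta(f).

    For arbitrary mu, values f(zeta) are integrated for polynomials only: their quotient sequences
    are explicit at every zeta and their values depend continuously on zeta.

    [adjoint] is a choice with a default. To go from finite rank to finite support, the case without
    adjoint can be excluded. For the converse an adjoint must be constructed by a Riesz
    representation, hence from completeness, which is proved for finitely many atoms, where D(mu)
    sits in a finite sum of copies of l^2.

    Finite rank k yields at first some number m of atoms; that m is k follows from the converse and
    the invariance of dimension. *)

Lemma sqr_modulusE z : modulus z ^+ 2 = complex.Re z ^+ 2 + complex.Im z ^+ 2.
Proof.
by case: z => a b; rewrite /modulus /= sqr_sqrtr ?addr_ge0 ?sqr_ge0.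
Qed.

Lemma modulus_ge0 z : 0 <= modulus z.
Proof. by case: z => a b; rewrite /modulus /= sqrtr_ge0. Qed.

Lemma modulusM z w : modulus (z * w) = modulus z * modulus w.
Proof. exact: ComplexField.Normc.normcM. Qed.

Lemma modulusX z n : modulus (z ^+ n) = modulus z ^+ n.
Proof.
elim: n => [|n IH]; last by rewrite !exprS modulusM IH.
by rewrite /modulus /= expr0n addr0 expr1n sqrtr1.
Qed.

Lemma normr_modulus z : `|z| = (modulus z)%:C%C.
Proof. by case: z. Qed.

Lemma modulusD z w : modulus (z + w) <= modulus z + modulus w.
Proof. by rewrite -lecR rmorphD /= -!normr_modulus ler_normD. Qed.

Lemma modulus0 : modulus (0 : Cplx R) = 0.
Proof. exact: ComplexField.Normc.normc0. Qed.

Lemma modulus_eq0 z : modulus z = 0 -> z = 0.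
Proof. exact: ComplexField.Normc.eq0_normc. Qed.

Lemma modulusN z : modulus (- z) = modulus z.
Proof. by apply: complexI; rewrite -!normr_modulus normrN. Qed.

Lemma modulusBC z w : modulus (z - w) = modulus (w - z).
Proof. by rewrite -modulusN opprB. Qed.

Lemma modulus_real t : modulus (t%:C%C : Cplx R) = `|t|.
Proof. by rewrite /modulus /= expr0n addr0 sqrtr_sqr. Qed.

Lemma modulus1 : modulus (1 : Cplx R) = 1.
Proof. by have := modulus_real 1; rewrite normr1. Qed.

Lemma modulusi : modulus ('i : Cplx R) = 1.
Proof. by apply: complexI; rewrite -normr_modulus normCi. Qed.

Lemma modulus_gt0 z : z != 0 -> 0 < modulus z.
Proof.
move=> z0; rewrite lt_neqAle modulus_ge0 andbT eq_sym.
by apply: contra_neq z0 => /modulus_eq0.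
Qed.

Lemma modulusB z w : modulus z - modulus w <= modulus (z - w).
Proof. by rewrite lerBlDr (le_trans _ (modulusD _ _))// subrK. Qed.

Lemma modulus_sum (I : Type) (r : seq I) (F : I -> Cplx R) :
  modulus (\sum_(i <- r) F i) <= \sum_(i <- r) modulus (F i).
Proof.
elim: r => [|x r IH]; first by rewrite !big_nil modulus0.
by rewrite !big_cons (le_trans (modulusD _ _))// lerD2l.
Qed.

Lemma Re_le_modulus z : `|complex.Re z| <= modulus z.
Proof.
rewrite -(@ler_pXn2r _ 2)// ?nnegrE ?modulus_ge0// sqr_modulusE.
by rewrite real_normK ?num_real// lerDl sqr_ge0.
Qed.

Lemma Im_le_modulus z : `|complex.Im z| <= modulus z.
Proof.
rewrite -(@ler_pXn2r _ 2)// ?nnegrE ?modulus_ge0// sqr_modulusE.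
by rewrite real_normK ?num_real// lerDr sqr_ge0.
Qed.

Lemma modulus_le_ReIm z : modulus z <= `|complex.Re z| + `|complex.Im z|.
Proof.
rewrite -(@ler_pXn2r _ 2)// ?nnegrE ?modulus_ge0 ?addr_ge0// sqr_modulusE.
rewrite sqrrD !real_normK ?num_real// addrAC lerDl.
by rewrite mulrn_wge0 ?mulr_ge0.
Qed.

Lemma sqr_modulus_parallelogram z w :
  modulus (z + w) ^+ 2 + modulus (z - w) ^+ 2 =
  2 * modulus z ^+ 2 + 2 * modulus w ^+ 2.
Proof. by rewrite !sqr_modulusE; case: z w => [a b] [c d] /=; ring. Qed.

Lemma sqr_modulusD z w :
  modulus (z + w) ^+ 2 <= 2 * modulus z ^+ 2 + 2 * modulus w ^+ 2.
Proof. by rewrite -sqr_modulus_parallelogram lerDl sqr_ge0. Qed.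

Lemma sqr_modulus_conj z : (modulus z ^+ 2)%:C%C = z * z^*.
Proof. by rewrite rmorphXn /= -normr_modulus normCK. Qed.

Lemma cvg_modulusP (T : Type) (F : set_system T) (FF : Filter F)
    (f : T -> Cplx R) z :
  f @ F --> z <->
  forall e : R, 0 < e -> \forall x \near F, modulus (z - f x) < e.
Proof.
split=> [/cvgrPdist_lt h e e0|h].
  have /h : 0 < (e%:C%C : R[i]) by rewrite ltcR.
  by apply: filterS => x; rewrite normr_modulus ltcR.
apply/cvgrPdist_lt => e e0.
(* In the partial order of [R[i]], [0 < e] forces [e] to be real. *)
have ee : e = (complex.Re e)%:C%C.
  by move: e0; case: e => a b; rewrite ltcE /= => /andP[/eqP -> _].
move: e0; rewrite {1}ee ltcR => /h; apply: filterS => x.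
by rewrite normr_modulus {2}ee ltcR.
Qed.

End Modulus.

(** * Polarization and the Riesz representation for a norm satisfying the parallelogram law *)

Section QuadraticNorm.
Variables (R : realType) (V : lmodType R[i]) (P : set V) (N : V -> R).
Implicit Types (x y z : V) (t : R) (c : R[i]).

(** [N] stands for a squared seminorm on a subspace. The subspace is a predicate on an ambient
    module because the Dirichlet space is a set inside the module of all functions. *)
Definition quad_norm : Prop :=
  [/\ [/\ P 0, forall x y, P x -> P y -> P (x + y) &
          forall c x, P x -> P (c *: x)],
      forall x, P x -> 0 <= N x,
      forall c x, P x -> N (c *: x) = modulus c ^+ 2 * N x &
      forall x y, P x -> P y -> N (x + y) + N (x - y) = 2 * N x + 2 * N y].

(** The real part of [polar_form]. Additivity and homogeneity are proved for it first, and carried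
    over by [polar_formE]. *)
Definition real_form x y : R := (N (x + y) - N (x - y)) / 4.

Definition polar_form x y : R[i] :=
  4^-1 * \sum_(j < 4) 'i ^+ j * (N (x + 'i ^+ j *: y))%:C%C.

Hypothesis QN : quad_norm.

Let P0 : P 0. Proof. by case: QN => -[]. Qed.
Let PD x y : P x -> P y -> P (x + y). Proof. by case: QN => -[_ + _] _ _ _; apply. Qed.
Let PZ c x : P x -> P (c *: x). Proof. by case: QN => -[_ _ +] _ _ _; apply. Qed.
Let PN x : P x -> P (- x). Proof. by rewrite -scaleN1r; exact: PZ. Qed.
Let PB x y : P x -> P y -> P (x - y). Proof. by move=> ? /PN; exact: PD. Qed.
Let N_ge0 x : P x -> 0 <= N x. Proof. by case: QN => _ + _ _; apply. Qed.
Let NZ c x : P x -> N (c *: x) = modulus c ^+ 2 * N x.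
Proof. by case: QN => _ _ + _; apply. Qed.
Let Npar x y : P x -> P y -> N (x + y) + N (x - y) = 2 * N x + 2 * N y.
Proof. by case: QN => _ _ _; apply. Qed.

Lemma quadN x : P x -> N (- x) = N x.
Proof. by move=> Px; rewrite -scaleN1r NZ// modulusN modulus1 expr1n mul1r. Qed.

Lemma quadNB x y : P x -> P y -> N (x - y) = N (y - x).
Proof. by move=> Px Py; rewrite -quadN ?opprB//; exact: PB. Qed.

Lemma quad0 : N 0 = 0.
Proof. by have := NZ 0 P0; rewrite scale0r modulus0 expr0n mul0r. Qed.

Lemma real_formC x y : P x -> P y -> real_form x y = real_form y x.
Proof. by move=> Px Py; rewrite /real_form quadNB// (addrC x). Qed.

Lemma real_form_diag x : P x -> real_form x x = N x.
Proof.
move=> Px; rewrite /real_form subrr quad0 subr0.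
have -> : x + x = (2%:C%C : R[i]) *: x.
  by rewrite rmorphMn rmorph1 scaler_nat mulr2n.
rewrite NZ// modulus_real.
by rewrite normr_nat; field.
Qed.

Lemma real_form0l x : P x -> real_form 0 x = 0.
Proof. by move=> Px; rewrite /real_form add0r sub0r quadN// subrr mul0r. Qed.

(** Subtract the parallelogram laws for the pairs [x + z], [y] and [x - z], [y]: the terms [N y]
    cancel. *)
Let real_form_mid x y z : P x -> P y -> P z ->
  real_form (x + y) z + real_form (x - y) z = 2 * real_form x z.
Proof.
move=> Px Py Pz; rewrite /real_form.
have h1 := Npar (PD Px Pz) Py; have h2 := Npar (PB Px Pz) Py.
rewrite (addrAC x z y) (addrAC x z) in h1.
rewrite (addrAC x (- z) y) (addrAC x (- z) (- y)) in h2.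
lra.
Qed.

Lemma real_formDl x y z : P x -> P y -> P z ->
  real_form (x + y) z = real_form x z + real_form y z.
Proof.
move=> Px Py Pz; pose h : R[i] := 2^-1.
(* The midpoint identity is applied to [u = (x + y) / 2] and [v = (x - y) / 2], for which
   [u + v = x] and [u - v = y]; applied to [u] and [u] it turns [2 * real_form u z] into
   [real_form (x + y) z]. *)
have hh v : h *: v + h *: v = v.
  by rewrite -scalerDl -[RHS]scale1r; congr (_ *: _); rewrite /h; field.
have Pu := PZ h (PD Px Py); have Pv := PZ h (PB Px Py).
have e1 := real_form_mid Pu Pv Pz; have e2 := real_form_mid Pu Pu Pz.
move: e1 e2; rewrite hh subrr real_form0l// addr0 => e1 ->.
have ex : h *: (x + y) + h *: (x - y) = x.
  by rewrite -scalerDr addrACA subrr addr0 scalerDr hh.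
have ey : h *: (x + y) - h *: (x - y) = y.
  by rewrite -scalerBr opprB (addrC x y) addrACA subrr addr0 scalerDr hh.
by rewrite -e1 ex ey.
Qed.

Lemma real_formNl x y : P x -> P y -> real_form (- x) y = - real_form x y.
Proof.
move=> Px Py; apply/eqP; rewrite -addr_eq0 addrC -real_formDl ?subrr ?real_form0l//.
exact: PN.
Qed.

Lemma real_form_bound x y t : P x -> P y ->
  `|4 * real_form (t%:C%C *: x) y| <= 2 * (t ^+ 2 * N x + N y).
Proof.
move=> Px Py; have Ptx := PZ t%:C%C Px.
have := Npar Ptx Py; have := N_ge0 (PD Ptx Py); have := N_ge0 (PB Ptx Py).
rewrite NZ// modulus_real real_normK ?num_real// /real_form => h1 h2 h3.
rewrite ler_norml; apply/andP; split; lra.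
Qed.

(* The additive map [t |-> B (t x) y - t B x y] has period 1 and is bounded by
   a quadratic, hence bounded, hence zero. *)
Lemma real_formZl t x y : P x -> P y ->
  real_form (t%:C%C *: x) y = t * real_form x y.
Proof.
move=> Px Py; pose psi s := real_form (s%:C%C *: x) y - s * real_form x y.
have psiD s u : psi (s + u) = psi s + psi u.
  by rewrite /psi rmorphD scalerDl real_formDl; [ring|exact: PZ..|].
have psi1 : psi 1 = 0 by rewrite /psi scale1r mul1r subrr.
have psi0 : psi 0 = 0 by apply/eqP; rewrite -(inj_eq (addrI (psi 0))) -psiD !addr0.
have psin s n : psi (n%:R * s) = n%:R * psi s.
  elim: n => [|n IH]; first by rewrite !mul0r psi0.
  by rewrite -natr1 !mulrDl psiD IH !mul1r.
have psiN s : psi (- s) = - psi s.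
  by apply/eqP; rewrite -addr_eq0 addrC -psiD subrr psi0.
have psinat n : psi n%:R = 0 by rewrite -[n%:R]mulr1 psin psi1 mulr0.
have psiint (m : int) : psi m%:~R = 0.
  by case: m => n; rewrite ?NegzE ?mulrNz ?psiN -pmulrn psinat// oppr0.
pose K := N x + N y + `|real_form x y|.
have psib s : `|psi s| <= K.
  have -> : psi s = psi (s - (Num.floor s)%:~R) by rewrite psiD psiN psiint subr0.
  set u := s - _.
  have u0 : 0 <= u by rewrite /u subr_ge0 floor_le.
  have u1 : u <= 1 by rewrite /u lerBlDl ltW// -intrD1 floorD1_gt.
  rewrite (le_trans (ler_normB _ _))// /K lerD//; last first.
    by rewrite normrM (ger0_norm u0) ler_piMl.
  have := real_form_bound u Px Py; rewrite normrM (@ger0_norm _ 4)// => h.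
  have u2 : u ^+ 2 * N x <= N x.
    by rewrite ler_piMl ?N_ge0// expr_le1.
  have := N_ge0 Px; have := N_ge0 Py; lra.
suff : psi t = 0 by move/eqP; rewrite subr_eq0 => /eqP.
apply/eqP; rewrite -normr_eq0 eq_le normr_ge0 andbT leNgt; apply/negP => p0.
have := psib ((Num.bound (K / `|psi t|))%:R * t).
rewrite psin normrM normr_nat leNgt -ltr_pdivrMr//.
suff -> : K / `|psi t| < (Num.bound (K / `|psi t|))%:R by [].
apply: archi_boundP; rewrite divr_ge0// /K !addr_ge0 ?N_ge0//.
Qed.

Lemma real_form_ii x y : P x -> P y ->
  real_form ('i *: x) ('i *: y) = real_form x y.
Proof.
move=> Px Py; rewrite /real_form -scalerDr -scalerBr !NZ ?modulusi ?expr1n ?mul1r//.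
- exact: PB.
- exact: PD.
Qed.

(** Multiplication by ['i] is an isometry with square -1, hence skew-adjoint for the real form. *)
Lemma real_form_il x y : P x -> P y ->
  real_form ('i *: x) y = - real_form x ('i *: y).
Proof.
move=> Px Py.
rewrite -real_form_ii ?scalerA ?real_formNl//; last exact: PZ.
by rewrite -expr2 sqrCi scaleN1r real_formNl//; exact: PZ.
Qed.

Lemma polar_formE x y : polar_form x y = (real_form x y)%:C%C + 'i * (real_form x ('i *: y))%:C%C.
Proof.
rewrite /polar_form !big_ord_recl big_ord0 addr0 /=.
rewrite /bump /= ?add1n ?addn0 ?add1n expr0 expr1 scale1r mul1r.
have -> : ('i : R[i]) ^+ 3 = - 'i by rewrite exprS sqrCi mulrN1.
rewrite sqrCi scaleN1r scaleNr /real_form.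
rewrite !rmorphM !rmorphB /= !fmorphV !rmorph_nat.
by field.
Qed.

Lemma polar_form_diag x : P x -> polar_form x x = (N x)%:C%C.
Proof.
move=> Px; rewrite polar_formE real_form_diag//.
have : real_form x ('i *: x) = 0.
  have Pix := PZ 'i Px; have := real_form_il Px Px.
  by rewrite real_formC//; lra.
by move=> ->; rewrite mulr0 addr0.
Qed.

Lemma polar_formDl x y z : P x -> P y -> P z ->
  polar_form (x + y) z = polar_form x z + polar_form y z.
Proof.
move=> Px Py Pz; rewrite !polar_formE.
rewrite !real_formDl//; last exact: PZ.
by rewrite !rmorphD /=; ring.
Qed.

Lemma polar_formC x y : P x -> P y -> polar_form y x = (polar_form x y)^*.
Proof.
move=> Px Py; rewrite !polar_formE rmorphD rmorphM /= conjCi.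
rewrite !conj_Creal ?Creal_real//; last 2 first.
- by rewrite complex_real.
- by rewrite complex_real.
rewrite (real_formC Py Px); congr (_ + _).
rewrite mulNr -mulrN -rmorphN/=.
by rewrite -real_form_il// real_formC//; exact: PZ.
Qed.

Lemma complexE_i c : exists a b : R, c = a%:C%C + 'i * b%:C%C.
Proof.
exists (complex.Re c), (complex.Im c); case: c => a b.
by rewrite -complexiE /=; simpc.
Qed.

Lemma polar_formZl c x y : P x -> P y -> polar_form (c *: x) y = c * polar_form x y.
Proof.
move=> Px Py; have [a [b ->]] := complexE_i c.
have Piy := PZ 'i Py; have Pix := PZ 'i Px.
rewrite scalerDl mulrC -scalerA polar_formDl; [|exact: PZ..|by []].
rewrite !polar_formE.
rewrite !real_formZl// !real_form_il// scalerA -expr2 sqrCi scaleN1r.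
rewrite (real_formC Px (PN Py)) real_formNl// (real_formC Py Px) opprK.
move: (real_form x y) (real_form x ('i *: y)) => p q; rewrite !rmorphM !rmorphN /=.
apply/eqP; rewrite -subr_eq0; apply/eqP.
(* [ring] treats ['i] as an indeterminate, so the difference is exhibited as a multiple of
   [1 + 'i ^+ 2]. *)
transitivity (- (b%:C%C * q%:C%C) * (1 + 'i ^+ 2)); first by ring.
by rewrite sqrCi subrr mulr0.
Qed.

Lemma polar_formDr x y z : P x -> P y -> P z ->
  polar_form z (x + y) = polar_form z x + polar_form z y.
Proof.
move=> Px Py Pz; rewrite (polar_formC (PD Px Py) Pz) polar_formDl// rmorphD /=.
by rewrite -!polar_formC.
Qed.

Lemma polar_formZr c x y : P x -> P y -> polar_form y (c *: x) = c^* * polar_form y x.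
Proof.
move=> Px Py; rewrite (polar_formC (PZ c Px) Py) polar_formZl// rmorphM /=.
by rewrite -polar_formC.
Qed.

Lemma polar_formBr x y z : P x -> P y -> P z ->
  polar_form z (x - y) = polar_form z x - polar_form z y.
Proof.
move=> Px Py Pz; rewrite polar_formDr//; last exact: PN.
by rewrite -scaleN1r polar_formZr// rmorphN1 mulN1r.
Qed.

Lemma polar_form0r x : P x -> polar_form x 0 = 0.
Proof. by move=> Px; rewrite -(scale0r x) polar_formZr// rmorph0 mul0r. Qed.

Lemma polar_form_sumr n (c : 'I_n -> R[i]) (F : 'I_n -> V) x :
  P x -> (forall i, P (F i)) ->
  P (\sum_i c i *: F i) /\
  polar_form x (\sum_i c i *: F i) = \sum_i (c i)^* * polar_form x (F i).
Proof.
move=> Px PF; apply: (big_ind2 (fun v s => P v /\ polar_form x v = s)).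
- by rewrite polar_form0r.
- by move=> v s v' s' [Pv <-] [Pv' <-]; rewrite polar_formDr//; split=> //; exact: PD.
- by move=> i _; rewrite polar_formZr//; split=> //; exact: PZ.
Qed.

Lemma two_real_form_le x y : P x -> P y -> 2 * real_form x y <= N x + N y.
Proof.
move=> Px Py; have := real_form_bound 1 Px Py; rewrite scale1r expr1n mul1r.
rewrite ler_norml => /andP[_]; lra.
Qed.

Lemma quad_normD t x y : P x -> P y ->
  N (x + t%:C%C *: y) = N x + t ^+ 2 * N y + 2 * (t * real_form y x).
Proof.
move=> Px Py; rewrite -real_formZl//.
have Pty := PZ t%:C%C Py.
have := Npar Px Pty; rewrite NZ// modulus_real real_normK ?num_real//.
rewrite (real_formC Pty Px) /real_form; lra.
Qed.

(** Completeness with a rate built in. The minimizing sequence in [riesz_real] satisfies exactly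
    this Cauchy bound, and the rate for the limit is what its variational inequality consumes. *)
Hypothesis complete : forall u : nat -> V, (forall n, P (u n)) ->
  (forall n m, N (u n - u m) <= n.+1%:R^-1 + m.+1%:R^-1) ->
  exists2 y, P y & exists K : R, forall n, N (u n - y) <= K * n.+1%:R^-1.

Let inv_nat_ge0 (x K : R) : (forall n, 0 <= x + K * n.+1%:R^-1) -> 0 <= x.
Proof.
move=> h; rewrite leNgt; apply/negP => x0.
have K0 : 0 < K by have := h 0%N; rewrite invr1 mulr1; lra.
have x0' : 0 < - x by rewrite oppr_gt0.
have := @archi_boundP _ (K / - x).
rewrite divr_ge0 ?ltW// => /(_ isT); rewrite ltr_pdivrMr// => hb.
have := h (Num.bound (K / - x)); apply/negP; rewrite -ltNge -ltrBrDl sub0r.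
rewrite ltr_pdivrMr// (lt_le_trans hb)// mulrC ler_wpM2l ?ltW//.
by rewrite ltr_nat.
Qed.

(* The representing vector is the limit of a minimizing sequence of
   [N x - 2 L x]. *)
Lemma riesz_real (L : V -> R) (K : R) :
  (forall x y, P x -> P y -> L (x + y) = L x + L y) ->
  (forall t x, P x -> L (t%:C%C *: x) = t * L x) ->
  (forall x, P x -> 2 * L x <= N x + K) ->
  exists2 y, P y & forall x, P x -> L x = real_form x y.
Proof.
move=> LD LZ LK; pose J x := N x - 2 * L x.
pose A := [set J x | x in P].
have A0 : A !=set0 by exists (J 0), 0.
have lbA : lbound A (- K) by move=> _ [x Px <-]; rewrite /J; have := LK _ Px; lra.
have hA : has_inf A by split=> //; exists (- K).
pose m := inf A.
have Jm x : P x -> m <= J x by move=> Px; apply: ge_inf; [exists (- K)|exists x].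
(* The factor 1/2 is fitted to [complete]: comparing [J] at the midpoint of [u n] and [u k] with
   [m], the parallelogram law bounds [N (u n - u k)] by [2 J (u n) + 2 J (u k) - 4 m]. *)
have /choice[u hu] n : exists x, P x /\ J x < m + 2^-1 * n.+1%:R^-1.
  have d0 : 0 < 2^-1 * n.+1%:R^-1 :> R by rewrite mulr_gt0 ?invr_gt0.
  by have [_ [x Px <-] ?] := inf_adherent d0 hA; exists x.
have Pu n : P (u n) by case: (hu n).
have [|y Py [K' hK']] := complete Pu.
  move=> n k; pose h : R[i] := (2^-1)%:C%C.
  have Pm : P (h *: (u n + u k)) by apply: PZ; exact: PD.
  have := Jm _ Pm; have [_] := hu n; have [_] := hu k; rewrite /J.
  rewrite LZ ?LD//; last exact: PD.
  rewrite NZ; last exact: PD.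
  rewrite modulus_real ger0_norm ?invr_ge0//.
  have := Npar (Pu n) (Pu k).
  rewrite (_ : (2^-1 : R) ^+ 2 = 4^-1); last by field.
  move: (n.+1%:R^-1) (k.+1%:R^-1) => p q.
  lra.
exists y => // x Px; apply/eqP; rewrite eq_sym -subr_eq0; apply/eqP.
set d := _ - _.
(* First variation: [J (u n + t x)] is at least [m], while [J (u n)] exceeds [m] by less than half
   of [1 / (n + 1)]. Replacing [u n] by [y] in the cross term costs [t ^+ 2 * N x], whence the
   factor 2, and [N (u n - y)], whence [K']. *)
have key t : 0 <= 2 * (t ^+ 2 * N x) + 2 * (t * d).
  apply: (@inv_nat_ge0 _ (2^-1 + K')) => n.
  have Pt := PZ t%:C%C Px.
  have := Jm _ (PD (Pu n) Pt); have [_] := hu n; rewrite /J.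
  rewrite quad_normD// LD// LZ//.
  have := two_real_form_le Pt (PB (Pu n) Py); rewrite real_formZl//; last exact: PB.
  rewrite NZ// modulus_real real_normK ?num_real//.
  rewrite (real_formC Px (PB (Pu n) Py)) real_formDl//; last exact: PN.
  rewrite real_formNl// (real_formC (Pu n))// (real_formC Py)//.
  have := hK' n.
  move: (n.+1%:R^-1) => p; rewrite /d (real_formC Px Py).
  rewrite -/J !mulrDl !mulrBr ?mulrDr. lra.
have Nx := N_ge0 Px.
(* Nearly the minimizer of the quadratic; the [+ 1] keeps the denominator positive when
   [N x = 0]. *)
have := key (- (d / (N x + 1))).
have N1 : N x + 1 != 0 by rewrite gt_eqF// ltr_wpDl.
rewrite (_ : _ + _ = - (2 * (d / (N x + 1)) ^+ 2)); last by field.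
rewrite oppr_ge0 pmulr_rle0// => h.
have : (d / (N x + 1)) ^+ 2 == 0 by rewrite eq_le h sqr_ge0.
by rewrite sqrf_eq0 mulf_eq0 invr_eq0 (negPf N1) orbF => /eqP.
Qed.

End QuadraticNorm.

(** * Square-summable sequences *)

Section SquareSummable.
Variable R : realType.
Implicit Types (a b : nat -> Cplx R) (c : Cplx R).

Definition l2_norm2 a : \bar R := (\sum_(0 <= n <oo) (modulus (a n) ^+ 2)%:E)%E.

Lemma l2_norm2_ge0 a : (0 <= l2_norm2 a)%E.
Proof. by apply: nneseries_ge0 => n _ _; rewrite lee_fin sqr_ge0. Qed.

Lemma l2_norm2_fin a : (l2_norm2 a < +oo)%E -> l2_norm2 a \is a fin_num.
Proof. by move=> h; rewrite ge0_fin_numE// l2_norm2_ge0. Qed.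

Lemma l2_norm2_0 : l2_norm2 (fun=> 0) = 0%E.
Proof. by apply: eseries0 => n _ _; rewrite modulus0 expr0n. Qed.

Lemma l2_parallelogram a b :
  (l2_norm2 (fun n => a n + b n)%R + l2_norm2 (fun n => a n - b n)%R =
   2%:E * l2_norm2 a + 2%:E * l2_norm2 b)%E.
Proof.
have ge0 (u : nat -> Cplx R) (n : nat) : (0 <= (modulus (u n) ^+ 2)%:E)%E.
  by rewrite lee_fin sqr_ge0.
rewrite /l2_norm2 -[in RHS]nneseriesZl// -[X in (_ = _ + X)%E]nneseriesZl//.
rewrite -!nneseriesD//; try by move=> n _ _; rewrite ?mule_ge0 ?lee_fin ?sqr_ge0.
by apply: eq_eseriesr => n _; rewrite -!EFinD sqr_modulus_parallelogram.
Qed.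

Lemma l2_norm2Z c a : l2_norm2 (fun n => c * a n) = ((modulus c ^+ 2)%:E * l2_norm2 a)%E.
Proof.
rewrite /l2_norm2 -nneseriesZl; last by move=> n _; rewrite lee_fin sqr_ge0.
by apply: eq_eseriesr => n _; rewrite modulusM exprMn.
Qed.

Lemma l2_norm2D_fin a b : (l2_norm2 a < +oo)%E -> (l2_norm2 b < +oo)%E ->
  (l2_norm2 (fun n => a n + b n)%R < +oo)%E.
Proof.
move=> fa fb; apply: (@le_lt_trans _ _ (2%:E * l2_norm2 a + 2%:E * l2_norm2 b)%E).
  by rewrite -l2_parallelogram leeDl// l2_norm2_ge0.
by rewrite lte_add_pinfty// lte_mul_pinfty.
Qed.

Lemma l2_norm2Z_fin c a : (l2_norm2 a < +oo)%E -> (l2_norm2 (fun n => c * a n)%R < +oo)%E.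
Proof. by move=> fa; rewrite l2_norm2Z lte_mul_pinfty// lee_fin sqr_ge0. Qed.

Lemma l2_norm2_shift a :
  l2_norm2 a = ((modulus (a 0%N) ^+ 2)%:E + l2_norm2 (fun n => a n.+1))%E.
Proof.
rewrite /l2_norm2 nneseries_recl//; last by move=> n _; rewrite lee_fin sqr_ge0.
rewrite -nneseries_addn//; last by move=> n; rewrite lee_fin sqr_ge0.
by congr (_ + _)%E; apply: eq_eseriesr => n _; rewrite addn1.
Qed.

Lemma l2_norm2_partial a k :
  ((\sum_(0 <= n < k) modulus (a n) ^+ 2)%:E <= l2_norm2 a)%E.
Proof.
by rewrite -sumEFin; apply: nneseries_lim_ge => n _ _; rewrite lee_fin sqr_ge0.
Qed.

Lemma l2_norm2_le a (M : R) :
  (forall k, \sum_(0 <= n < k) modulus (a n) ^+ 2 <= M) -> (l2_norm2 a <= M%:E)%E.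
Proof.
move=> h; apply: lime_le.
  by apply: is_cvg_nneseries => n _ _; rewrite lee_fin sqr_ge0.
by apply: nearW => k; rewrite sumEFin lee_fin.
Qed.

Lemma l2_norm2_term a n : ((modulus (a n) ^+ 2)%:E <= l2_norm2 a)%E.
Proof.
apply: le_trans (l2_norm2_partial a n.+1); rewrite lee_fin big_nat_recr//= lerDr.
by rewrite sumr_ge0// => i _; rewrite sqr_ge0.
Qed.

Lemma l2_norm2_eq0 a : l2_norm2 a = 0%E -> forall n, a n = 0.
Proof.
move=> a0 n; apply: modulus_eq0; apply/eqP; rewrite -sqrf_eq0 eq_le sqr_ge0 andbT.
by have := l2_norm2_term a n; rewrite a0 lee_fin.
Qed.

Lemma l2_bounded a : (l2_norm2 a < +oo)%E ->
  exists2 K : R, 0 <= K & forall n, modulus (a n) <= K.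
Proof.
move=> /l2_norm2_fin fa; exists (fine (l2_norm2 a) + 1).
  by rewrite addr_ge0// fine_ge0// l2_norm2_ge0.
move=> n; have := l2_norm2_term a n; rewrite -(fineK fa) lee_fin /= => h.
rewrite leNgt; apply/negP => h1.
have h0 : 0 <= fine (l2_norm2 a) by rewrite fine_ge0// l2_norm2_ge0.
nra.
Qed.

Lemma l2_small a (e : R) : (l2_norm2 a < +oo)%E -> 0 < e ->
  \forall n \near \oo, modulus (a n) < e.
Proof.
move=> fa e0.
have /nnseries_is_cvg/(_ fa)/cvg_series_cvg_0 : forall n, 0 <= modulus (a n) ^+ 2.
  by move=> n; rewrite sqr_ge0.
move=> /cvgrPdist_lt/(_ (e ^+ 2)); rewrite exprn_gt0// => /(_ isT).
apply: filterS => n; rewrite sub0r normrN ger0_norm ?sqr_ge0//.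
by rewrite ltr_pXn2r// nnegrE ?modulus_ge0 ?ltW.
Qed.

(** The real and imaginary parts are additive and 1-Lipschitz for the modulus, which reduces the
    claim to completeness of [R]. *)
Lemma cauchy_modulus_cvg (u : nat -> Cplx R) :
  (forall e : R, 0 < e ->
     exists n0, forall n m, (n0 <= n)%N -> (n0 <= m)%N -> modulus (u n - u m) < e) ->
  exists l : Cplx R, u @ \oo --> l.
Proof.
move=> hu.
have part (p : Cplx R -> R) : (forall z, `|p z| <= modulus z) ->
    (forall z w, p (z - w) = p z - p w) -> exists l : R, (p \o u) @ \oo --> l.
  move=> pl pB; apply/cvg_ex/cauchy_cvgP/cauchy_ballP => e e0.
  have [n0 h] := hu _ e0; pose A := (p \o u) @` [set n | n0 <= n]%N.
  exists (A, A); first by split; exists n0 => // n hn; exists n.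
  case=> _ _ [/= [n hn <-] [m hm <-]]; rewrite /ball /= /ball_ /= -pB.
  by rewrite (le_lt_trans (pl _))// h.
have [x hx] := part (@complex.Re R) (@Re_le_modulus R) ltac:(by case=> ? ? []).
have [y hy] := part (@complex.Im R) (@Im_le_modulus R) ltac:(by case=> ? ? []).
exists (x +i* y)%C; apply/cvg_modulusP => e e0.
have e20 : 0 < e / 2 by rewrite divr_gt0.
move/cvgrPdist_lt : hx => /(_ _ e20) hx; move/cvgrPdist_lt : hy => /(_ _ e20) hy.
near=> n; rewrite (le_lt_trans (modulus_le_ReIm _))// (splitr e) ltrD//.
  by rewrite raddfB /=; near: n.
by rewrite raddfB /=; near: n.
Unshelve. all: by end_near. Qed.

Lemma cvg_modulus (T : Type) (F : set_system T) (FF : Filter F)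
    (f : T -> Cplx R) c :
  f @ F --> c -> (fun x => modulus (f x)) @ F --> modulus c.
Proof.
move=> /cvg_modulusP h; apply/cvgrPdist_lt => e /h.
apply: filterS => x; apply: le_lt_trans; rewrite ler_norml modulusB andbT.
by rewrite lerNl opprB modulusBC modulusB.
Qed.

(** Each coordinate is Cauchy; the bound on every finite partial sum survives the limit in [m], and
    then passes to the full sum. The constant [C] allows for the masses of the atoms, which weight
    the norms of the quotient sequences. *)
Lemma l2_complete (u : nat -> nat -> Cplx R) (C : R) : 0 < C ->
  (forall n m, l2_norm2 (fun j => u n j - u m j)%R <=
               (C * (n.+1%:R^-1 + m.+1%:R^-1))%:E)%E ->
  exists l : nat -> Cplx R, (forall j, u ^~ j @ \oo --> l j) /\
    forall n, (l2_norm2 (fun j => u n j - l j)%R <= (C * n.+1%:R^-1)%:E)%E.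
Proof.
move=> C0 hu.
have /choice[l hl] j : exists l : Cplx R, u ^~ j @ \oo --> l.
  apply: cauchy_modulus_cvg => e e0.
  have e20 : 0 < e ^+ 2 / (2 * C) by rewrite divr_gt0 ?mulr_gt0 ?exprn_gt0.
  pose n0 := Num.bound (e ^+ 2 / (2 * C))^-1.
  have hn0 n : (n0 <= n)%N -> n.+1%:R^-1 < e ^+ 2 / (2 * C).
    move=> hn; rewrite invf_plt ?posrE//.
    have := @archi_boundP _ (e ^+ 2 / (2 * C))^-1; rewrite invr_ge0 ltW// => /(_ isT).
    by move=> /lt_le_trans; apply; rewrite ler_nat (leq_trans hn).
  exists n0 => n m /hn0 hn /hn0 hm.
  rewrite -(@ltr_pXn2r _ 2)// ?nnegrE ?modulus_ge0 ?ltW// -lte_fin.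
  apply: le_lt_trans (l2_norm2_term (fun j => u n j - u m j) j) _.
  apply: le_lt_trans (hu n m) _; rewrite lte_fin.
  rewrite (_ : e ^+ 2 = C * (e ^+ 2 / (2 * C) + e ^+ 2 / (2 * C))).
    by rewrite ltr_pM2l// ltrD.
  by field; rewrite gt_eqF.
exists l; split=> // n; apply: l2_norm2_le => k.
have cv : (fun m => \sum_(0 <= j < k) modulus (u n j - u m j) ^+ 2) @ \oo -->
    \sum_(0 <= j < k) modulus (u n j - l j) ^+ 2.
  apply: cvg_big => [|j _]; first exact: add_continuous.
  rewrite expr2; under eq_fun do rewrite expr2.
  by apply: cvgM; apply: cvg_modulus; apply: cvgB => //; exact: cvg_cst.
have cv2 : (fun m => C * (n.+1%:R^-1 + m.+1%:R^-1)) @ \oo --> C * (n.+1%:R^-1 + 0).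
  apply: cvgMl_tmp; apply: cvgD; first exact: cvg_cst.
  exact: cvg_harmonic.
rewrite addr0 in cv2.
apply: (ler_cvg_to cv cv2).
by apply: nearW => m; rewrite -lee_fin (le_trans (l2_norm2_partial _ k)).
Qed.

End SquareSummable.

(** * Power series and Hardy space *)

Section PowerSeries.
Variable R : realType.
Implicit Types (a b : nat -> Cplx R) (c z w zeta : Cplx R) (f g : Cplx R -> Cplx R).

Lemma geometric_sum_le (r : R) n m : 0 <= r < 1 ->
  \sum_(n <= i < n + m) r ^+ i <= r ^+ n / (1 - r).
Proof.
move=> /andP[r0 r1]; rewrite ler_pdivlMr ?subr_gt0//.
suff -> : (\sum_(n <= i < n + m) r ^+ i) * (1 - r) = r ^+ n - r ^+ (n + m).
  by rewrite gerBl exprn_ge0.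
elim: m => [|m IH]; first by rewrite addn0 big_geq// mul0r subrr.
by rewrite addnS big_nat_recr ?leq_addr//= mulrDl IH exprS; ring.
Qed.

Lemma modulus_lim_le (u : nat -> Cplx R) c (B : R) :
  u @ \oo --> c -> (forall n, modulus (u n) <= B) -> modulus c <= B.
Proof.
move=> /cvg_modulus uc uB; apply: (ler_cvg_to uc (@cvg_cst _ B _ _ _)).
exact: nearW.
Qed.

Lemma cvg_uniq (u : nat -> Cplx R) c w : u @ \oo --> c -> u @ \oo --> w -> c = w.
Proof. exact: (@cvg_unique (Cplx R) (@norm_hausdorff _ _) (u @ \oo) _ c w). Qed.

Lemma geometric_series_cvg (u : nat -> Cplx R) (K r : R) : 0 <= r < 1 ->
  (forall n, modulus (u n) <= K * r ^+ n) ->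
  exists l : Cplx R, series u @ \oo --> l.
Proof.
move=> r01 hu; have /andP[r0 r1] := r01.
have K0 : 0 <= K by have := hu 0%N; rewrite expr0 mulr1; apply: le_trans; exact: modulus_ge0.
apply: cauchy_modulus_cvg => e e0.
have K1 : 0 < e * (1 - r) / (K + 1).
  by rewrite divr_gt0 ?mulr_gt0 ?subr_gt0// ltr_wpDl.
have : (fun n => r ^+ n) @ \oo --> 0 by apply: cvg_expr; rewrite ger0_norm.
move=> /cvgrPdist_lt/(_ _ K1)[n0 _ hn0]; exists n0.
have key n m : (n0 <= n)%N -> modulus (series u (n + m)%N - series u n) < e.
  move=> hn; rewrite sub_series_geq ?leq_addr//.
  apply: le_lt_trans (modulus_sum _ _) _.
  apply: (@le_lt_trans _ _ (K * (r ^+ n / (1 - r)))).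
    apply: le_trans (_ : K * \sum_(n <= i < n + m) r ^+ i <= _).
      by rewrite mulr_sumr ler_sum.
    by rewrite ler_wpM2l// geometric_sum_le.
  have := hn0 _ hn; rewrite /= sub0r normrN ger0_norm ?exprn_ge0// => hr.
  rewrite mulrA ltr_pdivrMr ?subr_gt0//.
  apply: le_lt_trans (_ : K * (e * (1 - r) / (K + 1)) < _).
    by rewrite ler_wpM2l// ltW.
  rewrite mulrCA -[ltRHS]mulr1 ltr_pM2l ?mulr_gt0 ?subr_gt0//.
  by rewrite ltr_pdivrMr ?ltr_wpDl// mul1r ltrDl.
move=> n m hn hm; have [nm|/ltnW mn] := leqP n m.
  by rewrite modulusBC -(subnKC nm) key.
by rewrite -(subnKC mn) key.
Qed.

Lemma power_series_exists a : (l2_norm2 a < +oo)%E ->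
  exists f, power_series_on_disk f a.
Proof.
move=> /l2_bounded[K K0 hK].
have /choice[f hf] z : exists l : Cplx R,
    (disk z -> series (fun n => a n * z ^+ n) @ \oo --> l) /\ (~ disk z -> l = 0).
  have [dz|ndz] := pselect (disk z); last by exists 0.
  have [||l hl] := @geometric_series_cvg (fun n => a n * z ^+ n) K (modulus z).
  - by rewrite modulus_ge0.
  - by move=> n; rewrite modulusM modulusX ler_wpM2r// exprn_ge0 ?modulus_ge0.
  by exists l.
by exists f; split=> z; case: (hf z).
Qed.

Lemma power_series_fun_uniq f g a :
  power_series_on_disk f a -> power_series_on_disk g a -> f = g.
Proof.
move=> [f1 f2] [g1 g2]; apply/funext => z.
have [dz|ndz] := pselect (disk z); last by rewrite f2// g2.
exact: (cvg_uniq (f1 z dz) (g1 z dz)).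
Qed.

Lemma power_seriesD f g a b :
  power_series_on_disk f a -> power_series_on_disk g b ->
  power_series_on_disk (fun z => f z + g z) (fun n => a n + b n).
Proof.
move=> [f1 f2] [g1 g2]; split=> z dz; last by rewrite f2// g2// addr0.
rewrite (_ : series _ = series (fun n => a n * z ^+ n) + series (fun n => b n * z ^+ n)).
  by apply: cvgD; [exact: f1|exact: g1].
apply/funext => k; rewrite fctE /series /= -big_split /=.
by apply: eq_bigr => i _; rewrite mulrDl.
Qed.

Lemma power_seriesZ c f a :
  power_series_on_disk f a -> power_series_on_disk (fun z => c * f z) (fun n => c * a n).
Proof.
move=> [f1 f2]; split=> z dz; last by rewrite f2// mulr0.
rewrite (_ : series _ = (fun k => c * series (fun n => a n * z ^+ n) k)).
  by apply: cvgMl_tmp; exact: f1.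
apply/funext => k; rewrite /series /= mulr_sumr.
by apply: eq_bigr => i _; rewrite mulrA.
Qed.

Lemma power_series0 : power_series_on_disk (fun=> 0) (fun=> 0 : Cplx R).
Proof.
split=> // z _; rewrite (_ : series _ = fun=> 0); first exact: cvg_cst.
by apply/funext => k; rewrite /series /= big1// => i _; rewrite mul0r.
Qed.

Definition shift_up a : nat -> Cplx R := fun n => if n is m.+1 then a m else 0.

Lemma power_series_Mz f a :
  power_series_on_disk f a -> power_series_on_disk (Mz f) (shift_up a).
Proof.
move=> [f1 f2]; split=> z dz; last by rewrite /Mz f2// mulr0.
rewrite -cvg_shiftS /=.
rewrite (_ : (fun _ => _) = (fun k => z * series (fun n => a n * z ^+ n) k)).
  by apply: cvgMl_tmp; exact: f1.
apply/funext => k; rewrite /series /= big_nat_recl// mul0r add0r mulr_sumr.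
by apply: eq_bigr => i _; rewrite exprS mulrCA.
Qed.

(** Convergence at radius [r = d / 2] bounds [modulus (b n) * r ^+ n] by some [K]. At the point
    [t * r] the terms after the constant one then add up to at most [2 * K * t], so [b 0] is that
    small for every small [t]. *)
Let punctured_series_coef0 b (d : R) : 0 < d ->
  (forall z, 0 < modulus z < d -> series (fun n => b n * z ^+ n) @ \oo --> (0 : Cplx R)) ->
  b 0%N = 0.
Proof.
move=> d0 hb; pose r := d / 2.
have r0 : 0 < r by rewrite divr_gt0.
have hr : modulus (r%:C%C : Cplx R) = r by rewrite modulus_real gtr0_norm.
have /hb h0 : 0 < modulus (r%:C%C : Cplx R) < d.
  by rewrite hr r0 /= /r ltr_pdivrMr// ltr_pMr// ltr1n.
have [K K0 hK] : exists2 K : R, 0 <= K & forall n, modulus (b n) * r ^+ n <= K.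
  have /cvgP/cvg_series_cvg_0/cvg_modulus := h0.
  rewrite modulus0 => /cvgP/cvg_seq_bounded/pinfty_ex_gt0[K K0 h].
  exists K; first exact: ltW.
  move=> n; have := h n I; rewrite /= modulusM modulusX hr; apply: le_trans.
  exact: ler_norm.
have key (t : R) : 0 < t <= 2^-1 -> modulus (b 0%N) <= 2 * K * t.
  move=> /andP[t0 t1]; pose z : Cplx R := (t * r)%:C%C.
  have mz : modulus z = t * r by rewrite modulus_real gtr0_norm// mulr_gt0.
  have /hb hz : 0 < modulus z < d.
    rewrite mz mulr_gt0//= (@le_lt_trans _ _ r)//.
      by rewrite ler_piMl ?(ltW r0)// (le_trans t1)// invf_le1// ler1n.
    by rewrite /r ltr_pdivrMr// ltr_pMr// ltr1n.
  have cz : (fun k => b 0%N - series (fun n => b n * z ^+ n) k.+1) @ \oo --> b 0%N.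
    rewrite -[X in _ --> X]subr0; apply: cvgB; first exact: cvg_cst.
    by rewrite cvg_shiftS.
  apply: (modulus_lim_le cz) => k.
  rewrite /series /= big_nat_recl// expr0 mulr1 opprD addrA subrr add0r modulusN.
  apply: le_trans (modulus_sum _ _) _.
  apply: (@le_trans _ _ (K * \sum_(1 <= i < 1 + k) t ^+ i)).
    rewrite big_add1 add1n /= mulr_sumr; apply: ler_sum => i _.
    rewrite modulusM modulusX mz exprMn mulrCA mulrC ler_wpM2r//.
    by rewrite exprn_ge0// ltW.
  have t11 : 0 <= t < 1 by rewrite ltW// (le_lt_trans t1)// invf_lt1// ltr1n.
  rewrite (mulrC 2) -mulrA ler_wpM2l// (le_trans (geometric_sum_le 1 k t11))//.
  rewrite expr1 mulrC ler_wpM2r ?(ltW t0)// -[leRHS]invrK lef_pV2 ?posrE ?invr_gt0//.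
    by rewrite lerBrDl -lerBrDr; move: t1; lra.
  by move: t11; lra.
apply: modulus_eq0; apply/eqP; rewrite eq_le modulus_ge0 andbT leNgt; apply/negP => b0.
(* The [t] used next is at most 1/4 and makes [2 * K * t] at most half of [modulus (b 0)], a
   contradiction. *)
have K1 : 0 < 4 * (K + modulus (b 0%N)) by rewrite mulr_gt0// ltr_wpDl.
have := key (modulus (b 0%N) / (4 * (K + modulus (b 0%N)))).
rewrite divr_gt0//= ler_pdivrMr//.
have -> : modulus (b 0%N) <= 2^-1 * (4 * (K + modulus (b 0%N))) by lra.
move=> /(_ isT); rewrite mulrA ler_pdivlMr//; nra.
Qed.

(** The puncture allows the induction to divide by [z], and lets [quotient_seriesP] avoid [zeta]
    when [zeta = 0]. *)
Lemma punctured_series_eq0 b (d : R) : 0 < d ->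
  (forall z, 0 < modulus z < d -> series (fun n => b n * z ^+ n) @ \oo --> (0 : Cplx R)) ->
  forall n, b n = 0.
Proof.
move=> d0 hb n; elim: n b hb => [|n IH] b hb; first exact: punctured_series_coef0 hb.
apply: (IH (fun n => b n.+1)) => z /[dup] /andP[z0 _] /hb; rewrite -cvg_shiftS /= => hz.
have nz : z != 0 by apply: contraTneq z0 => ->; rewrite modulus0 ltxx.
rewrite (_ : series _ = (fun k => z^-1 * series (fun n => b n * z ^+ n) k.+1)).
  by rewrite -[X in _ --> X](mulr0 z^-1); apply: cvgMl_tmp.
apply/funext => k; rewrite /series /= big_nat_recl//.
rewrite (punctured_series_coef0 d0 hb) mul0r add0r mulr_sumr.
by apply: eq_bigr => i _; rewrite exprS; field.
Qed.

Lemma power_series_coef_uniq f a b :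
  power_series_on_disk f a -> power_series_on_disk f b -> a = b.
Proof.
move=> fa /(power_seriesZ (-1)) /(power_seriesD fa)[h _]; apply/funext => n.
apply/eqP; rewrite -subr_eq0; apply/eqP.
rewrite -[_ - _]/((fun n => a n - b n) n); apply: (@punctured_series_eq0 _ 1) => // z.
move=> /andP[_ dz]; have := h z dz; rewrite mulN1r subrr.
rewrite (_ : (fun n => (a n + -1 * b n) * z ^+ n) = (fun n => (a n - b n) * z ^+ n))//.
by apply/funext => k; rewrite mulN1r.
Qed.

Lemma h2_norm2E f a : power_series_on_disk f a -> h2_norm2 f = l2_norm2 a.
Proof.
move=> fa; rewrite /h2_norm2 -[RHS]ereal_inf1; congr ereal_inf.
apply/seteqP; split => [_ [b fb <-]|_ ->] /=; last by exists a.
by rewrite (power_series_coef_uniq fb fa).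
Qed.

Lemma hardyP f : hardy f <-> exists2 a, power_series_on_disk f a & (l2_norm2 a < +oo)%E.
Proof.
split=> [|[a fa la]]; last by rewrite /hardy /= (h2_norm2E fa).
rewrite /hardy /= => hf.
have [a fa] : exists a, power_series_on_disk f a.
  apply: contrapT => /forallNP h; move: hf; rewrite /h2_norm2.
  have -> : power_series_on_disk f = set0 by apply/seteqP; split=> // a /h.
  by rewrite image_set0 ereal_inf0.
by exists a => //; rewrite -(h2_norm2E fa).
Qed.

(* AM-GM: [2 |b_n| r ^ n <= t |b_n|^2 + r ^ (2 n) / t]. *)
Lemma power_series_growth g b z (M t : R) : power_series_on_disk g b ->
  (l2_norm2 b <= M%:E)%E -> disk z -> 0 < t ->
  (1 - modulus z) * modulus (g z) <= (t * M * (1 - modulus z) + t^-1) / 2.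
Proof.
move=> [hg _] bM dz t0; have dz1 : 0 < 1 - modulus z by rewrite subr_gt0.
rewrite mulrC -ler_pdivlMr//; apply: (modulus_lim_le (hg z dz)) => k.
apply: le_trans (modulus_sum _ _) _.
apply: (@le_trans _ _ ((t * \sum_(0 <= i < k) modulus (b i) ^+ 2 +
                        t^-1 * \sum_(0 <= i < 0 + k) modulus z ^+ i) / 2)).
  rewrite !mulr_sumr -big_split /= mulr_suml; apply: ler_sum => i _.
  rewrite modulusM modulusX; set x := modulus (b i); set y := modulus z ^+ i.
  have y0 : 0 <= y by rewrite exprn_ge0 ?modulus_ge0.
  have y1 : y <= 1 by rewrite exprn_ile1 ?modulus_ge0// ltW.
  rewrite ler_pdivlMr//.
  apply: (@le_trans _ _ (t * x ^+ 2 + t^-1 * y ^+ 2)); last first.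
    rewrite lerD2l ler_wpM2l ?invr_ge0 ?(ltW t0)//.
    by rewrite expr2 ler_piMr.
  rewrite -subr_ge0 (_ : _ - _ = t^-1 * (t * x - y) ^+ 2); last by field; rewrite gt_eqF.
  by rewrite mulr_ge0 ?sqr_ge0 ?invr_ge0 ?(ltW t0).
rewrite ler_pdivlMr// mulrAC ler_pdivrMr//= mulfVK// mulrDl lerD//.
  rewrite ler_wpM2r ?(ltW dz1)// ler_wpM2l ?(ltW t0)//.
  by rewrite -lee_fin (le_trans (l2_norm2_partial _ _)).
rewrite -mulrA ler_piMr ?invr_ge0 ?(ltW t0)//.
have := @geometric_sum_le (modulus z) 0 k; rewrite modulus_ge0 => /(_ dz).
by rewrite expr0 ler_pdivlMr// mulrC.
Qed.

End PowerSeries.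

(** * The local Dirichlet integral in terms of Taylor coefficients *)

Section LocalDirichlet.
Variable R : realType.
Implicit Types (a b : nat -> Cplx R) (c z w zeta : Cplx R) (f g : Cplx R -> Cplx R).

(* The square-summable Taylor coefficients [b] of [(f - w) / (z - zeta)], for
   the unique admissible value [w = a 0 + zeta * b 0]. *)
Definition diff_seq a zeta b : Prop :=
  (forall n, b n - zeta * b n.+1 = a n.+1) /\ (l2_norm2 b < +oo)%E.

Lemma quotient_seriesE f g a b zeta : power_series_on_disk f a ->
  power_series_on_disk g b -> (forall n, b n - zeta * b n.+1 = a n.+1) ->
  forall z, disk z -> f z = a 0%N + zeta * b 0%N + (z - zeta) * g z.
Proof.
move=> [fa _] gb hab z dz.
have [hd _] := power_seriesD (power_series_Mz gb) (power_seriesZ (- zeta) gb).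
have := hd z dz; have := fa z dz; rewrite -cvg_shiftS => h1; rewrite -cvg_shiftS => h2.
apply: (cvg_uniq h1); rewrite (_ : (fun _ => _) =
  (fun k => a 0%N + zeta * b 0%N +
     series (fun n => (shift_up b n + - zeta * b n) * z ^+ n) k.+1)).
  by apply: cvgD; [exact: cvg_cst|move: h2; rewrite /Mz mulrBl mulNr].
apply/funext => k; rewrite /series /= !big_nat_recl// !expr0 !mulr1 /=.
rewrite add0r mulNr addrA addrK; congr (_ + _).
by apply: eq_bigr => i _; rewrite -hab mulNr.
Qed.

Lemma quotient_seriesP f g a b zeta w : power_series_on_disk f a ->
  power_series_on_disk g b -> difference_quotient f zeta w g ->
  forall n, b n - zeta * b n.+1 = a n.+1.
Proof.
move=> fa gb hq n.
have hd := power_seriesD (power_series_Mz gb) (power_seriesZ (- zeta) gb).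
have {hd}[hd _] := power_seriesD hd (power_seriesZ (-1) fa).
(* The coefficients of [w + (z - zeta) g - f]. The unknown [w] enters at index 0 only, and the
   recursion is read off at the positive indices. *)
pose e n := shift_up b n + - zeta * b n + -1 * a n + (if n is 0%N then w else 0).
suff : e n.+1 = 0.
  by move/eqP; rewrite /e /= addr0 mulN1r subr_eq0 mulNr => /eqP.
(* A punctured disk around 0 that misses [zeta], the point where the quotient is unconstrained. *)
pose d := if zeta == 0 then 1 else Num.min 1 (modulus zeta).
have d0 : 0 < d.
  by rewrite /d; case: eqVneq => // z0; rewrite lt_min ltr01 modulus_gt0.
apply: (@punctured_series_eq0 R e d) => // z /andP[z0 zd].
have dz : disk z.
  apply: lt_le_trans zd _; rewrite /d; case: eqVneq => // _.
  by rewrite ge_min lexx.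
have nz : z != zeta.
  move: zd; rewrite /d; case: eqVneq => [-> _|_].
    by apply: contraTneq z0 => ->; rewrite modulus0 ltxx.
  by rewrite lt_min => /andP[_]; apply: contraTneq => ->; rewrite ltxx.
have := hd z dz; rewrite -cvg_shiftS => h; rewrite -cvg_shiftS.
have h0 : w + (Mz g z + - zeta * g z + -1 * f z) = 0.
  by rewrite /Mz (hq z dz nz); move: nz; rewrite -subr_eq0 => nz; field.
have := cvgD (@cvg_cst _ w _ \oo _) h; rewrite h0.
suff -> : (fun k => series (fun n => e n * z ^+ n) k.+1) =
    cst w + (fun k => series (fun n => (shift_up b n + - zeta * b n + -1 * a n) * z ^+ n) k.+1).
  exact.
apply/funext => k; rewrite fctE /series /= !big_nat_recl// /e !expr0 !mulr1 /=.
by under eq_bigr do rewrite addr0; ring.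
Qed.

(** The difference [d] of two solutions satisfies [d n = zeta * d n.+1], so its moduli are
    nondecreasing on the closed disk; being square-summable, they also tend to 0. *)
Lemma diff_seq_uniq a zeta b b' : modulus zeta <= 1 ->
  diff_seq a zeta b -> diff_seq a zeta b' -> b = b'.
Proof.
move=> z1 [hb lb] [hb' lb']; pose d n := b n + -1 * b' n.
have ld : (l2_norm2 d < +oo)%E by exact/l2_norm2D_fin/l2_norm2Z_fin.
have dS n : d n = zeta * d n.+1.
  apply/eqP; rewrite -subr_eq0 /d !mulN1r.
  rewrite (_ : _ - _ = (b n - zeta * b n.+1) - (b' n - zeta * b' n.+1)); last by ring.
  by rewrite hb hb' subrr.
have dmono n k : modulus (d n) <= modulus (d (k + n)%N).
  elim: k => // k /le_trans; apply.
  by rewrite dS modulusM addSn ler_piMl// modulus_ge0.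
apply/funext => n; apply/eqP; rewrite -subr_eq0 -mulN1r -/(d n); apply/eqP.
apply: modulus_eq0; apply/eqP; rewrite eq_le modulus_ge0 andbT leNgt; apply/negP => d0.
have [N _ /(_ (N + n)%N)] := l2_small ld d0.
by rewrite /= leq_addr => /(_ isT); rewrite ltNge dmono.
Qed.

Lemma difference_quotient_diff_seq f g a zeta w : power_series_on_disk f a ->
  difference_quotient f zeta w g -> (h2_norm2 g < +oo)%E ->
  exists2 b, diff_seq a zeta b & h2_norm2 g = l2_norm2 b.
Proof.
move=> fa hq /hardyP[b gb lb]; exists b; last exact: h2_norm2E.
by split=> //; exact: quotient_seriesP hq.
Qed.

(** With [w] the claimed limit, [f z - w = (z - zeta) * g z]. In a Stolz region [modulus (z - zeta)]
    is less than [M * (1 - modulus z)], and [(1 - modulus z) * modulus (g z)] tends to 0 at the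
    circle because [g] is in H^2. *)
Lemma nontangential_quotient f a b zeta : power_series_on_disk f a ->
  diff_seq a zeta b -> modulus zeta = 1 ->
  nontangential_limit f zeta (a 0%N + zeta * b 0%N).
Proof.
move=> fa [hab lb] z1 M M1; have [g gb] := power_series_exists lb.
have M0 : 0 < M by rewrite (lt_trans _ M1).
apply/cvg_modulusP => e e0; rewrite near_withinE.
have B0 : 0 <= fine (l2_norm2 b) by rewrite fine_ge0// l2_norm2_ge0.
set B := fine _ in B0.
have bB : (l2_norm2 b <= B%:E)%E by rewrite /B fineK// l2_norm2_fin.
(* With this [t] the second term of the growth bound contributes [e / 4]; the first contributes at
   most [e / 2] once [1 - modulus z] is below [e / (M * t * (B + 1))]. *)
pose t := 2 * M / e; have B1 : 0 < B + 1 by rewrite ltr_wpDl.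
have t0 : 0 < t by rewrite divr_gt0 ?mulr_gt0.
have MtB : 0 < M * t * (B + 1) := mulr_gt0 (mulr_gt0 M0 t0) B1.
have del0 : 0 < e / (M * t * (B + 1)) by exact: divr_gt0.
have /cvg_modulusP/(_ _ del0) : (@id (Cplx R)) @ nbhs zeta --> zeta by exact: cvg_id.
apply: filterS => z hz [dz hM]; have := power_series_growth gb bB dz t0.
rewrite (quotient_seriesE fa gb hab dz) opprD addrA subrr add0r modulusN modulusM => hg.
have dz1 : 0 < 1 - modulus z by rewrite subr_gt0.
have dz2 : 1 - modulus z <= modulus (zeta - z) by rewrite -z1 modulusB.
have g0 := modulus_ge0 (g z).
apply: (@le_lt_trans _ _ (M * ((1 - modulus z) * modulus (g z)))).
  by rewrite mulrA ler_wpM2r// ltW.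
apply: le_lt_trans (ler_wpM2l (ltW M0) hg) _.
have h1 : M * t * (B + 1) * (1 - modulus z) < e.
  by rewrite mulrC -ltr_pdivlMr// (le_lt_trans dz2).
have h2 : M * t^-1 = e / 2 by rewrite /t; field; rewrite !gt_eqF.
have h3 : 0 <= M * t * (1 - modulus z) := mulr_ge0 (mulr_ge0 (ltW M0) (ltW t0)) (ltW dz1).
rewrite mulrA mulrDr h2; nra.
Qed.

(** By [diff_seq_uniq], every [w] with a finite quotient norm leads to the same [b], so the infimum
    over [w] collapses. On the circle, [nontangential_quotient] guarantees that an admissible [w]
    occurs. *)
Lemma local_dirichlet_fin f a zeta b : power_series_on_disk f a ->
  modulus zeta <= 1 -> diff_seq a zeta b -> local_dirichlet f zeta = l2_norm2 b.
Proof.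
move=> fa z1 hb; have [hab lb] := hb; have [g gb] := power_series_exists lb.
have low w : (l2_norm2 b <= difference_quotient_norm2 f zeta w)%E.
  apply: le_ereal_inf_tmp => _ [g' hg' <-].
  have [/(difference_quotient_diff_seq fa hg')[b' hb' ->]|] := ltP (h2_norm2 g') +oo%E.
    by rewrite (diff_seq_uniq z1 hb hb').
  by rewrite leye_eq => /eqP ->; rewrite leey.
have up w : w = a 0%N + zeta * b 0%N -> (difference_quotient_norm2 f zeta w <= l2_norm2 b)%E.
  move=> ->; apply: ereal_inf_lbound; exists g; last exact: h2_norm2E.
  move=> z dz nz; rewrite (quotient_seriesE fa gb hab dz) addrAC subrr add0r.
  by rewrite mulrC mulKf// subr_eq0.
apply/eqP; rewrite eq_le /local_dirichlet; case: ifPn => [dz|ndz]; apply/andP; split=> //.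
- by apply: up; rewrite (quotient_seriesE fa gb hab dz) subrr mul0r addr0.
- apply: le_trans (up _ erefl); apply: ereal_inf_lbound.
  exists (a 0%N + zeta * b 0%N) => //; apply: nontangential_quotient => //.
  by apply/eqP; rewrite eq_le z1 leNgt.
- by apply: le_ereal_inf_tmp => _ [w _ <-].
Qed.

Lemma local_dirichlet_pinfty f a zeta : power_series_on_disk f a ->
  (forall b, ~ diff_seq a zeta b) -> local_dirichlet f zeta = +oo%E.
Proof.
move=> fa nb; have low w : difference_quotient_norm2 f zeta w = +oo%E.
  apply/eqP; rewrite -leye_eq; apply: le_ereal_inf_tmp => _ [g hg <-].
  rewrite leNgt; apply/negP => /(difference_quotient_diff_seq fa hg)[b hb _].
  exact: nb hb.
rewrite /local_dirichlet; case: ifP => // _.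
by apply/eqP; rewrite -leye_eq; apply: le_ereal_inf_tmp => _ [w _ <-]; rewrite low lexx.
Qed.

Lemma local_dirichletP f a zeta : power_series_on_disk f a -> modulus zeta <= 1 ->
  (exists2 b, diff_seq a zeta b & local_dirichlet f zeta = l2_norm2 b) \/
  ((forall b, ~ diff_seq a zeta b) /\ local_dirichlet f zeta = +oo%E).
Proof.
move=> fa z1; have [[b hb]|/forallNP nb] := pselect (exists b, diff_seq a zeta b).
  by left; exists b => //; rewrite (local_dirichlet_fin fa z1 hb).
by right; split; [exact: nb|exact: local_dirichlet_pinfty fa nb].
Qed.

Lemma local_dirichlet_lty f a zeta : power_series_on_disk f a -> modulus zeta <= 1 ->
  (local_dirichlet f zeta < +oo)%E ->
  exists2 b, diff_seq a zeta b & local_dirichlet f zeta = l2_norm2 b.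
Proof. by move=> fa z1 h; have [//|[_ h']] := local_dirichletP fa z1; rewrite h' in h. Qed.

Lemma local_dirichlet_ge0 f a zeta : power_series_on_disk f a -> modulus zeta <= 1 ->
  (0 <= local_dirichlet f zeta)%E.
Proof.
by move=> fa z1; have [[b _ ->]|[_ ->]] := local_dirichletP fa z1; rewrite ?l2_norm2_ge0 ?le0y.
Qed.

Lemma diff_seqD a a' zeta b b' : diff_seq a zeta b -> diff_seq a' zeta b' ->
  diff_seq (fun n => a n + a' n) zeta (fun n => b n + b' n).
Proof.
move=> [h l] [h' l']; split; last exact: l2_norm2D_fin.
by move=> n; rewrite -h -h'; ring.
Qed.

Lemma diff_seqZ c a zeta b : diff_seq a zeta b ->
  diff_seq (fun n => c * a n) zeta (fun n => c * b n).
Proof.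
move=> [h l]; split; last exact: l2_norm2Z_fin.
by move=> n; rewrite -h; ring.
Qed.

Lemma diff_seqB a a' zeta b b' : diff_seq a zeta b -> diff_seq a' zeta b' ->
  diff_seq (fun n => a n - a' n) zeta (fun n => b n - b' n).
Proof.
move=> h /(diff_seqZ (-1)) /(diff_seqD h).
by under eq_fun do rewrite mulN1r; under [X in diff_seq _ _ X]eq_fun do rewrite mulN1r.
Qed.

Lemma diff_seq_shift_up a zeta b : diff_seq a zeta b ->
  diff_seq (shift_up a) zeta (fun n => if n is m.+1 then b m else a 0%N + zeta * b 0%N).
Proof.
move=> [h l]; split; first by case=> [|n]; rewrite /= ?addrK// h.
by rewrite l2_norm2_shift lte_add_pinfty// ltry.
Qed.

Lemma diff_seq_shift_down a zeta b : diff_seq (shift_up a) zeta b ->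
  diff_seq a zeta (fun n => b n.+1).
Proof.
move=> [h l]; split; first by move=> n; rewrite (h n.+1).
by apply: le_lt_trans l; rewrite [leRHS]l2_norm2_shift leeDr// lee_fin sqr_ge0.
Qed.

Lemma local_dirichletZ c f a zeta : power_series_on_disk f a -> modulus zeta <= 1 ->
  local_dirichlet (fun z => c * f z) zeta =
  ((modulus c ^+ 2)%:E * local_dirichlet f zeta)%E.
Proof.
move=> fa z1; have cfa := power_seriesZ c fa.
have [[b hb ->]|[nb ->]] := local_dirichletP fa z1.
  by rewrite (local_dirichlet_fin cfa z1 (diff_seqZ c hb)) l2_norm2Z.
(* For [c = 0] the right side is [0 * +oo], which is 0 by convention, and so is the left side. *)
have [c0|c0] := eqVneq c 0.
  move: cfa; rewrite c0 modulus0 expr0n mul0e => cfa.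
  rewrite (local_dirichlet_fin cfa z1 (b := fun=> 0)) ?l2_norm2_0//.
  by split=> [n|]; rewrite ?l2_norm2_0 ?ltry// mulr0 subr0 mul0r.
rewrite gt0_muley ?lte_fin ?exprn_gt0 ?modulus_gt0//.
apply: local_dirichlet_pinfty cfa _ => b /(diff_seqZ c^-1).
under eq_fun do rewrite mulKf//.
exact: nb.
Qed.

(** For finite values this is the law in l^2. Infinite values match as well: solutions for [f] and
    [g] give solutions for [f + g] and [f - g] by sum and difference, and conversely by half sum and
    half difference. *)
Lemma local_dirichlet_parallelogram f g a a' zeta :
  power_series_on_disk f a -> power_series_on_disk g a' -> modulus zeta <= 1 ->
  (local_dirichlet (fun z => f z + g z)%R zeta + local_dirichlet (fun z => f z - g z)%R zeta =
   2%:E * local_dirichlet f zeta + 2%:E * local_dirichlet g zeta)%E.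
Proof.
move=> fa ga z1; have fga := power_seriesD fa ga.
have fgB : power_series_on_disk (fun z => f z - g z) (fun n => a n - a' n).
  have := power_seriesD fa (power_seriesZ (-1) ga).
  by under eq_fun do rewrite mulN1r; under [X in power_series_on_disk _ X]eq_fun do rewrite mulN1r.
have inf2 (x y : \bar R) : (0 <= x)%E -> (0 <= y)%E -> x = +oo%E \/ y = +oo%E ->
    (x + y = +oo)%E.
  by move=> x0 y0 [->|->]; [rewrite addye// -ltNye (lt_le_trans _ y0)|rewrite addey// -ltNye (lt_le_trans _ x0)].
have pos2 x : (0 <= x)%E -> (0 <= 2%:E * x :> \bar R)%E by exact: mule_ge0.
have ey : (2%:E * +oo = +oo :> \bar R)%E by rewrite gt0_muley ?lte_fin.
have f0 := local_dirichlet_ge0 fa z1; have g0 := local_dirichlet_ge0 ga z1.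
have fg0 := local_dirichlet_ge0 fga z1; have fgB0 := local_dirichlet_ge0 fgB z1.
have [[b hb eb]|[nb eb]] := local_dirichletP fga z1; last first.
  transitivity (+oo : \bar R)%E; first by apply: inf2 => //; left.
  apply/esym/inf2; [exact: pos2..|].
  have [[c hc _]|[_ ->]] := local_dirichletP fa z1; last by left; rewrite ey.
  have [[d hd _]|[_ ->]] := local_dirichletP ga z1; last by right; rewrite ey.
  by case: (nb _ (diff_seqD hc hd)).
have [[b' hb' eb']|[nb eb']] := local_dirichletP fgB z1; last first.
  transitivity (+oo : \bar R)%E; first by apply: inf2 => //; right.
  apply/esym/inf2; [exact: pos2..|].
  have [[c hc _]|[_ ->]] := local_dirichletP fa z1; last by left; rewrite ey.
  have [[d hd _]|[_ ->]] := local_dirichletP ga z1; last by right; rewrite ey.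
  by case: (nb _ (diff_seqB hc hd)).
have hc := diff_seqZ 2^-1 (diff_seqD hb hb').
have hd := diff_seqZ 2^-1 (diff_seqB hb hb').
have ea : (fun n => 2^-1 * (a n + a' n + (a n - a' n))) = a.
  by apply/funext => n; field.
have ea' : (fun n => 2^-1 * (a n + a' n - (a n - a' n))) = a'.
  by apply/funext => n; field.
rewrite ea in hc; rewrite ea' in hd.
rewrite eb eb' (local_dirichlet_fin fa z1 hc) (local_dirichlet_fin ga z1 hd).
rewrite -(l2_parallelogram (fun n => 2^-1 * (b n + b' n)) (fun n => 2^-1 * (b n - b' n))).
by congr (_ + _)%E; congr l2_norm2; apply/funext => n; field.
Qed.

Lemma local_dirichlet_Mz f a zeta b : power_series_on_disk f a -> modulus zeta <= 1 ->
  diff_seq a zeta b -> local_dirichlet (Mz f) zeta =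
  (local_dirichlet f zeta + (modulus (a 0%N + zeta * b 0%N) ^+ 2)%:E)%E.
Proof.
move=> fa z1 hb; rewrite (local_dirichlet_fin fa z1 hb).
rewrite (local_dirichlet_fin (power_series_Mz fa) z1 (diff_seq_shift_up hb)).
by rewrite l2_norm2_shift addeC.
Qed.

End LocalDirichlet.

(** * Measurability of the local Dirichlet integral *)

Section LocalDirichletMeasurable.
Variable R : realType.
Implicit Types (a b : nat -> Cplx R) (c z w zeta : Cplx R) (f g : Cplx R -> Cplx R).

(** Iterating [b n = a n.+1 + zeta * b n.+1] gives [b n] as the limit of these sums in [N]. *)
Definition diff_partial a n N zeta : Cplx R := \sum_(j < N) zeta ^+ j * a (n + j).+1.

Lemma diff_partialD a n k N zeta :
  diff_partial a n (k + N) zeta = diff_partial a n k zeta + zeta ^+ k * diff_partial a (n + k) N zeta.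
Proof.
rewrite /diff_partial big_split_ord /= mulr_sumr; congr (_ + _).
by apply: eq_bigr => i _; rewrite exprD mulrA addnA.
Qed.

Lemma diff_partialE a n N zeta b : diff_seq a zeta b ->
  diff_partial a n N zeta = b n - zeta ^+ N * b (n + N)%N.
Proof.
move=> [h _]; elim: N => [|N IH].
  by rewrite /diff_partial big_ord0 addn0 expr0 mul1r subrr.
by rewrite /diff_partial big_ord_recr /= -/(diff_partial a n N zeta) IH -h addnS exprSr; ring.
Qed.

Let sqr_modulus_ge0 z : (0 <= (modulus z ^+ 2)%:E)%E.
Proof. by rewrite lee_fin sqr_ge0. Qed.

Let limsup_cvg (u : nat -> Cplx R) c : u @ \oo --> c ->
  limn_esup (fun N => (modulus (u N) ^+ 2)%:E) = (modulus c ^+ 2)%:E.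
Proof.
move=> /cvg_modulus h.
have : (fun N => (modulus (u N) ^+ 2)%:E) @ \oo --> (modulus c ^+ 2)%:E.
  apply: cvg_EFin; first exact: nearW.
  by rewrite expr2; under eq_fun do rewrite expr2; apply: cvgM.
by move=> /[dup] /cvgP/is_cvg_limn_esupE -> /cvg_lim; apply.
Qed.

(* A countable formula, hence measurable in [zeta]. No convergence of the inner
   partial sums has to be required: if the limsups are summable then they tend
   to 0, which by [diff_partialD] makes the partial sums Cauchy. *)
Lemma local_dirichletE f a zeta : power_series_on_disk f a -> modulus zeta <= 1 ->
  local_dirichlet f zeta =
  (\sum_(0 <= n <oo) limn_esup (fun N => (modulus (diff_partial a n N zeta) ^+ 2)%:E))%E.
Proof.
move=> fa z1.
have zX n : modulus (zeta ^+ n) <= 1 by rewrite modulusX exprn_ile1// modulus_ge0.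
have [[b hb ->]|[nb ->]] := local_dirichletP fa z1.
  apply: eq_eseriesr => n _; apply/esym/limsup_cvg/cvg_modulusP => e e0.
  have [N0 _ hN] := l2_small hb.2 e0; exists N0 => // N hN0.
  rewrite (diff_partialE _ _ hb) opprB addrC subrK modulusM.
  apply: le_lt_trans (hN (n + N)%N _).
    by rewrite ler_piMl ?modulus_ge0.
  by rewrite /= (leq_trans hN0)// leq_addl.
apply/esym/eqP; rewrite -leye_eq leNgt; apply/negP.
pose L n := limn_esup (fun N => (modulus (diff_partial a n N zeta) ^+ 2)%:E).
rewrite -/(L _) => hL; rewrite -[X in (X < _)%E]/(\sum_(0 <= n <oo) L n)%E in hL.
have L0 n : (0 <= L n)%E by apply: limf_esup_ge0.
have Lfin n : L n \is a fin_num.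
  rewrite ge0_fin_numE//; apply: le_lt_trans hL.
  apply: le_trans (nneseries_lim_ge n.+1 _) => //.
  by rewrite big_nat_recr//= leeDr// sume_ge0.
have LE : (\sum_(0 <= n <oo) L n = \sum_(0 <= n <oo) (fine (L n))%:E)%E.
  by apply: eq_eseriesr => n _; rewrite fineK.
have Lcvg e : 0 < e -> \forall n \near \oo, (L n < e%:E)%E.
  move=> e0; have : (\sum_(0 <= n <oo) (fine (L n))%:E < +oo)%E by rewrite -LE.
  move=> /(nnseries_is_cvg (fun n => fine_ge0 (L0 n))).
  move=> /cvg_series_cvg_0/cvgrPdist_lt/(_ _ e0); apply: filterS => n.
  by rewrite sub0r normrN ger0_norm ?fine_ge0// -lte_fin fineK.
have /choice[b hb] n : exists l : Cplx R, (fun N => diff_partial a n N zeta) @ \oo --> l.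
  apply: cauchy_modulus_cvg => e e0.
  have e20 : 0 < (e / 2) ^+ 2 by rewrite exprn_gt0// divr_gt0.
  have [k _ hk] := Lcvg _ e20.
  have {hk} : (L (n + k)%N < ((e / 2) ^+ 2)%:E)%E by apply: hk; rewrite /= leq_addl.
  rewrite {1}/L /limn_esup limf_esupE => /ereal_inf_lt[_ [V [N0 _ hV] <-]] hN.
  have key N : (k + N0 <= N)%N ->
      modulus (diff_partial a n k zeta - diff_partial a n N zeta) < e / 2.
    move=> kN; rewrite -(subnKC (leq_trans (leq_addr _ _) kN)) diff_partialD.
    rewrite opprD addrA subrr add0r modulusN modulusM.
    apply: le_lt_trans (_ : modulus (diff_partial a (n + k) (N - k) zeta) < _).
      by rewrite ler_piMl ?modulus_ge0.
    rewrite -(@ltr_pXn2r _ 2)// ?nnegrE ?modulus_ge0 ?divr_ge0 ?ltW//.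
    rewrite -lte_fin; apply: le_lt_trans hN; apply: ereal_sup_ubound.
    by exists (N - k)%N => //; apply: hV; rewrite /= leq_subRL// (leq_trans _ kN)// leq_addr.
  exists (k + N0)%N => N M hN' hM.
  rewrite (_ : _ - _ = (diff_partial a n k zeta - diff_partial a n M zeta) -
     (diff_partial a n k zeta - diff_partial a n N zeta)); last by ring.
  by rewrite (le_lt_trans (modulusD _ _))// modulusN (splitr e) ltrD// key.
apply: (nb b); split => [n|]; last first.
  rewrite (_ : l2_norm2 b = \sum_(0 <= n <oo) L n)%E//.
  by apply: eq_eseriesr => n _; rewrite /L (limsup_cvg (hb n)).
have h1 := hb n; rewrite -cvg_shiftS in h1.
have eS : (fun N => diff_partial a n N.+1 zeta) =
    (fun N => a n.+1 + zeta * diff_partial a n.+1 N zeta).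
  apply/funext => N; rewrite -add1n diff_partialD /diff_partial big_ord1.
  by rewrite expr0 mul1r addn0 expr1 addn1.
rewrite eS in h1.
have h2 : (fun N => a n.+1 + zeta * diff_partial a n.+1 N zeta) @ \oo --> a n.+1 + zeta * b n.+1.
  apply: cvgD; first exact: cvg_cst.
  by apply: cvgMl_tmp; exact: hb.
by rewrite (cvg_uniq h1 h2) addrK.
Qed.

Lemma continuous_borelC_measurable (phi : Cplx R -> R) :
  continuous phi -> measurable_fun [set: borelC R] (phi : borelC R -> R).
Proof.
move=> /continuousP cphi; apply: (measurability _ (RGenOpens.measurableE R)).
move=> _ [_ [x [y ->] <-]]; rewrite setTI; apply: sub_gen_smallest.
exact/cphi/interval_open.
Qed.

Lemma modulus_continuous : continuous (@modulus R).
Proof. by move=> z; exact: (@cvg_modulus R _ (nbhs z) _ id z cvg_id). Qed.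

Lemma closed_disk_measurable : measurable (@closed_disk R : set (borelC R)).
Proof.
rewrite -[X in measurable X]setCK; apply: measurableC; apply: sub_gen_smallest.
rewrite (_ : ~` _ = @modulus R @^-1` [set x | 1 < x]).
  by move/continuousP : modulus_continuous; apply; exact: open_gt.
by apply/seteqP; split=> z; rewrite /closed_disk /= ltNge => /negP.
Qed.

Lemma complex_exprn_continuous n : continuous ((fun z => z ^+ n) : Cplx R -> Cplx R).
Proof.
move=> z; elim: n => [|n /(continuousM (@cvg_id _ _)) ih]; first exact: cst_continuous.
by rewrite /continuous_at exprS; under eq_fun do rewrite exprS; exact: ih.
Qed.

Lemma diff_partial_continuous a n N : continuous (diff_partial a n N).
Proof.
apply: continuous_big => [|j _]; first exact: add_continuous.
by move=> z; exact: (continuousM (@complex_exprn_continuous j z) (@cst_continuous _ _ (a (n + j).+1) z)).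
Qed.

Lemma local_dirichlet_measurable f a : power_series_on_disk f a ->
  measurable_fun (@closed_disk R : set (borelC R)) (local_dirichlet f : borelC R -> \bar R).
Proof.
move=> fa.
pose F (z : borelC R) := (\sum_(0 <= n <oo)
  limn_esup (fun N => (modulus (diff_partial a n N z) ^+ 2)%:E))%E.
apply: (eq_measurable_fun F); first by move=> z; rewrite inE => z1; rewrite (local_dirichletE fa).
rewrite /F.
apply: (ge0_emeasurable_sum (P := xpredT)
  (h := fun n (z : borelC R) => limn_esup (fun N => (modulus (diff_partial a n N z) ^+ 2)%:E))).
- by move=> n z _ _; apply: limf_esup_ge0.
- move=> n _; apply: measurable_funTS; apply: measurable_fun_limn_esup => N.
  apply/measurable_EFinP; apply: continuous_borelC_measurable => z.
  have h : {for z, continuous (fun z => modulus (diff_partial a n N z))}.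
    by apply: continuous_comp; [exact: diff_partial_continuous|exact: modulus_continuous].
  exact: (continuousM h h).
Qed.

End LocalDirichletMeasurable.

(** * The Dirichlet-type space *)

Section DirichletSpaceTheory.
Variables (R : realType) (mu : {finite_measure set (borelC R) -> \bar R}).
Implicit Types (a b : nat -> Cplx R) (c z w zeta : Cplx R) (f g : Cplx R -> Cplx R).

Local Notation D := (@closed_disk R : set (borelC R)).
Local Notation DI := (dirichlet_integral mu).
Local Notation N := (dirichlet_norm2 mu).

Let mD : measurable D. Proof. exact: closed_disk_measurable. Qed.

Lemma dirichlet_integral_ge0 f : (exists a, power_series_on_disk f a) -> (0 <= DI f)%E.
Proof. by move=> [a fa]; apply: integral_ge0 => z z1; exact: local_dirichlet_ge0 fa z1. Qed.

Lemma dirichlet_spaceP f : dirichlet_space mu f <->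
  exists2 a, power_series_on_disk f a & (l2_norm2 a < +oo)%E /\ (DI f < +oo)%E.
Proof.
split=> [[/hardyP[a fa la] If]|[a fa [la If]]]; first by exists a.
by split=> //; apply/hardyP; exists a.
Qed.

Lemma dirichlet_norm2E f a : dirichlet_space mu f -> power_series_on_disk f a ->
  (N f)%:E = (l2_norm2 a + DI f)%E.
Proof.
move=> [/hardyP[a' fa' la] If] fa; rewrite /dirichlet_norm2 (h2_norm2E fa) fineK//.
rewrite (power_series_coef_uniq fa fa') fin_numD l2_norm2_fin//=.
by rewrite ge0_fin_numE// dirichlet_integral_ge0//; exists a.
Qed.

Lemma dirichlet_integral_parallelogram f g a a' :
  power_series_on_disk f a -> power_series_on_disk g a' ->
  (DI (fun z => f z + g z)%R + DI (fun z => f z - g z)%R = 2%:E * DI f + 2%:E * DI g)%E.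
Proof.
move=> fa ga.
have fgB : power_series_on_disk (fun z => f z - g z) (fun n => a n - a' n).
  have := power_seriesD fa (power_seriesZ (-1) ga).
  by under eq_fun do rewrite mulN1r; under [X in power_series_on_disk _ X]eq_fun do rewrite mulN1r.
have fga := power_seriesD fa ga.
have pos h e : power_series_on_disk h e -> forall z, D z -> (0 <= local_dirichlet h z)%E.
  by move=> he z z1; exact: local_dirichlet_ge0 he z1.
have two h e : power_series_on_disk h e ->
    (2%:E * DI h = \int[mu]_(z in D) (2%:E * local_dirichlet h z))%E.
  move=> he; rewrite ge0_integralZl//; first exact: local_dirichlet_measurable he.
  exact: pos he.
rewrite [X in (_ = X + _)%E](two _ _ fa) [X in (_ = _ + X)%E](two _ _ ga) /dirichlet_integral -!ge0_integralD//.
- apply: eq_integral => z; rewrite inE => z1.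
  exact: local_dirichlet_parallelogram fa ga z1.
- by move=> z z1; rewrite mule_ge0// (pos _ _ fa).
- by apply: measurable_funeM; exact: local_dirichlet_measurable fa.
- by move=> z z1; rewrite mule_ge0// (pos _ _ ga).
- by apply: measurable_funeM; exact: local_dirichlet_measurable ga.
- exact: pos fga.
- exact: local_dirichlet_measurable fga.
- exact: pos fgB.
- exact: local_dirichlet_measurable fgB.
Qed.

Lemma dirichlet_integralZ c f a : power_series_on_disk f a ->
  DI (fun z => c * f z) = ((modulus c ^+ 2)%:E * DI f)%E.
Proof.
move=> fa; rewrite /dirichlet_integral -ge0_integralZl//.
- by apply: eq_integral => z; rewrite inE => z1; exact: local_dirichletZ fa z1.
- exact: local_dirichlet_measurable fa.
- by move=> z z1; exact: local_dirichlet_ge0 fa z1.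
- by rewrite lee_fin sqr_ge0.
Qed.

Lemma dirichlet_spaceZ c f : dirichlet_space mu f -> dirichlet_space mu (fun z => c * f z).
Proof.
move=> /dirichlet_spaceP[a fa [la If]]; apply/dirichlet_spaceP.
exists (fun n => c * a n); first exact: power_seriesZ.
split; first exact: l2_norm2Z_fin.
by rewrite (dirichlet_integralZ c fa) lte_mul_pinfty// lee_fin sqr_ge0.
Qed.

Lemma dirichlet_spaceD f g : dirichlet_space mu f -> dirichlet_space mu g ->
  dirichlet_space mu (fun z => f z + g z).
Proof.
move=> /dirichlet_spaceP[a fa [la If]] /dirichlet_spaceP[b gb [lb Ig]].
apply/dirichlet_spaceP.
exists (fun n => a n + b n); first exact: power_seriesD.
split; first exact: l2_norm2D_fin.
apply: (@le_lt_trans _ _ (2%:E * DI f + 2%:E * DI g)%E).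
  rewrite -(dirichlet_integral_parallelogram fa gb) leeDl// dirichlet_integral_ge0//.
  have := power_seriesD fa (power_seriesZ (-1) gb).
  by under eq_fun do rewrite mulN1r; eexists; eassumption.
apply: lte_add_pinfty; apply: lte_mul_pinfty; [by []|by []|exact: If|by []|by []|exact: Ig].
Qed.

Lemma local_dirichlet0 zeta : modulus zeta <= 1 -> local_dirichlet (fun=> 0) zeta = 0%E.
Proof.
move=> z1; rewrite (local_dirichlet_fin (power_series0 R) z1 (b := fun=> 0)) ?l2_norm2_0//.
by split=> [n|]; rewrite ?l2_norm2_0 ?ltry// mulr0 subr0.
Qed.

Lemma dirichlet_space0 : dirichlet_space mu (fun=> 0).
Proof.
apply/dirichlet_spaceP; exists (fun=> 0); first exact: power_series0.
split; first by rewrite l2_norm2_0 ltry.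
rewrite /dirichlet_integral integral0_eq ?ltry// => z z1.
exact: local_dirichlet0.
Qed.

Lemma dirichlet_quad_norm : quad_norm (V := (Cplx R -> Cplx R)) (dirichlet_space mu) N.
Proof.
split.
- split; first exact: dirichlet_space0.
  + by move=> f g; exact: dirichlet_spaceD.
  + by move=> c f; exact: dirichlet_spaceZ.
- move=> f /[dup] Df /dirichlet_spaceP[a fa _]; rewrite -lee_fin (dirichlet_norm2E Df fa).
  by rewrite adde_ge0 ?l2_norm2_ge0 ?dirichlet_integral_ge0//; exists a.
- move=> c f /[dup] Df /dirichlet_spaceP[a fa _]; apply: EFin_inj.
  rewrite (dirichlet_norm2E (dirichlet_spaceZ c Df) (power_seriesZ c fa)).
  rewrite EFinM (dirichlet_norm2E Df fa) l2_norm2Z (dirichlet_integralZ c fa).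
  by rewrite (ge0_muleDr _ (l2_norm2_ge0 a))//; apply: dirichlet_integral_ge0; exists a.
- move=> f g /[dup] Df /dirichlet_spaceP[a fa _] /[dup] Dg /dirichlet_spaceP[b gb _].
  have gNb := power_seriesZ (-1) gb; have DNg := dirichlet_spaceZ (-1) Dg.
  have eB : (fun z => f z + -1 * g z) = f - g by apply/funext => z; rewrite mulN1r.
  have := dirichlet_norm2E (dirichlet_spaceD Df DNg) (power_seriesD fa gNb).
  have := dirichlet_norm2E (dirichlet_spaceD Df Dg) (power_seriesD fa gb).
  rewrite eB => e1 e2.
  have e3 := dirichlet_norm2E Df fa; have e4 := dirichlet_norm2E Dg gb.
  have pf : (0 <= DI f)%E by apply: dirichlet_integral_ge0; exists a.
  have pg : (0 <= DI g)%E by apply: dirichlet_integral_ge0; exists b.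
  have l2B : (fun n => a n + -1 * b n) = (fun n => a n - b n).
    by apply/funext => n; rewrite mulN1r.
  have e5 := dirichlet_integral_parallelogram fa gb; rewrite l2B in e2.
  have la0 := l2_norm2_ge0 a; have lb0 := l2_norm2_ge0 b; have e6 := l2_parallelogram a b.
  move: (N (f + g)) (N (f - g)) (N f) (N g) e1 e2 e3 e4 => n1 n2 n3 n4.
  move: (DI _) (DI _) (DI f) (DI g) pf pg e5 => d1 d2 d3 d4 pf pg e5 e1 e2 e3 e4.
  apply: EFin_inj; rewrite EFinD e1 e2 EFinD !EFinM e3 e4 addeACA e6 e5.
  by rewrite (ge0_muleDr _ la0 pf) (ge0_muleDr _ lb0 pg) [RHS]addeACA.
Qed.

Lemma dirichlet_innerE f g :
  dirichlet_inner mu f g = polar_form (V := (Cplx R -> Cplx R)) N f g.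
Proof. by []. Qed.

Lemma dirichlet_norm2_eq0 f : dirichlet_space mu f -> N f = 0 -> f = (fun=> 0).
Proof.
move=> /[dup] Df /dirichlet_spaceP[a fa _] N0.
have := dirichlet_norm2E Df fa; rewrite N0 => /esym/eqP.
rewrite padde_eq0 ?l2_norm2_ge0 ?dirichlet_integral_ge0//; last by exists a.
move=> /andP[/eqP /l2_norm2_eq0 a0 _].
apply: (power_series_fun_uniq fa).
by rewrite (_ : a = fun=> 0); [exact: power_series0|exact/funext].
Qed.

(** From [modulus (a 0 + zeta * b 0) ^+ 2 <= 2 * modulus (a 0) ^+ 2 + 2 * modulus (b 0) ^+ 2], where
    the last square is at most D_zeta(f): this accounts for 3 = 1 + 2 and for the factor 2. The
    crude bound avoids integrating the values f(zeta) of a general [f]. *)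
Lemma dirichlet_integral_Mz_le f a : power_series_on_disk f a ->
  (DI (Mz f) <= 3%:E * DI f + (2 * modulus (a 0%N) ^+ 2)%:E * mu D)%E.
Proof.
move=> fa; have K0 : 0 <= 2 * modulus (a 0%N) ^+ 2 by rewrite mulr_ge0 ?sqr_ge0.
have [pos mes] : (forall z, D z -> (0 <= local_dirichlet f z)%E) /\
    measurable_fun D (local_dirichlet f : borelC R -> \bar R).
  by split; [move=> z; exact: local_dirichlet_ge0 fa|exact: local_dirichlet_measurable fa].
have mes3 : measurable_fun D (fun z : borelC R => (3%:E * local_dirichlet f z)%E).
  exact: measurable_funeM.
rewrite -integral_cst// -ge0_integralZl// -ge0_integralD//; last first.
  by move=> z z1; rewrite mule_ge0// pos.
apply: ge0_le_integral => //.
- by move=> z z1; exact: local_dirichlet_ge0 (power_series_Mz fa) z1.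
- exact: local_dirichlet_measurable (power_series_Mz fa).
- by apply: emeasurable_funD.
move=> z z1; have [[b hb eb]|[_ ->]] := local_dirichletP fa z1; last first.
  by rewrite gt0_muley ?lte_fin// addye ?leey.
rewrite (local_dirichlet_Mz fa z1 hb) eb.
have h := l2_norm2_term b 0; have lb := hb.2.
rewrite -(fineK (l2_norm2_fin lb)) lee_fin in h *.
rewrite -EFinM -!EFinD lee_fin.
have := sqr_modulusD (a 0%N) (z * b 0%N).
have : modulus (z * b 0%N) ^+ 2 <= modulus (b 0%N) ^+ 2.
  by rewrite ler_pXn2r ?nnegrE ?modulus_ge0// modulusM ler_piMl ?modulus_ge0.
lra.
Qed.

Lemma dirichlet_space_Mz f : dirichlet_space mu f -> dirichlet_space mu (Mz f).
Proof.
move=> /dirichlet_spaceP[a fa [la If]]; apply/dirichlet_spaceP.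
exists (shift_up a); first exact: power_series_Mz.
split; first by rewrite l2_norm2_shift (_ : shift_up a 0 = 0)// modulus0 expr0n add0e.
apply: le_lt_trans (dirichlet_integral_Mz_le fa) _.
apply: lte_add_pinfty; apply: lte_mul_pinfty => //.
  by rewrite lee_fin mulr_ge0 ?sqr_ge0.
by rewrite -ge0_fin_numE// fin_num_measure.
Qed.

Lemma dirichlet_norm2_Mz_le f : dirichlet_space mu f ->
  N (Mz f) <= (3 + 2 * fine (mu D)) * N f.
Proof.
move=> /[dup] Df /dirichlet_spaceP[a fa [la If]].
have fmu : mu D \is a fin_num by exact: fin_num_measure.
have fD : DI f \is a fin_num.
  by rewrite ge0_fin_numE// dirichlet_integral_ge0//; exists a.
have hM := dirichlet_norm2E (dirichlet_space_Mz Df) (power_series_Mz fa).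
rewrite l2_norm2_shift (_ : shift_up a 0 = 0)// modulus0 expr0n add0e in hM.
have hl : ((N (Mz f))%:E <= l2_norm2 a + (3%:E * DI f + (2 * modulus (a 0%N) ^+ 2)%:E * mu D))%E.
  by rewrite hM leeD2l// dirichlet_integral_Mz_le.
have hN := dirichlet_norm2E Df fa; have ha := l2_norm2_term a 0.
have I0 : (0 <= DI f)%E by apply: dirichlet_integral_ge0; exists a.
have m0 : (0 <= mu D)%E by [].
have x0 := sqr_ge0 (modulus (a 0%N)).
move: hl hN ha I0 m0; rewrite -(fineK fmu) -(fineK fD) -(fineK (l2_norm2_fin la)).
rewrite -!EFinM -!EFinD !lee_fin => hl [->] ha I0 m0.
move: (fine (mu D)) (fine (DI f)) (fine (l2_norm2 a)) (modulus _ ^+ 2) (N _) hl ha I0 m0 x0.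
move=> m I l x n hl ha I0 m0 x0; apply: le_trans hl _.
have := mulr_ge0 m0 I0; have : 0 <= m * (l - x) by rewrite mulr_ge0// subr_ge0.
by move=> h1 h2 /=; nra.
Qed.

End DirichletSpaceTheory.

(** * Polynomials and finitely supported measures *)

Section PolynomialFunctions.
Variable R : realType.
Implicit Types (p q : {poly R[i]}) (c z zeta : Cplx R).

Definition poly_on_disk p : Cplx R -> Cplx R :=
  fun z => if modulus z < 1 then p.[z] else 0.

Lemma poly_on_disk_series p : power_series_on_disk (poly_on_disk p) (fun n => p`_n).
Proof.
split=> z dz; last by rewrite /poly_on_disk; case: ifP => // /dz.
rewrite /poly_on_disk ifT//.
have e n : (size p <= n)%N -> series (fun n => p`_n * z ^+ n) n = p.[z].
  by move=> hn; rewrite (horner_coef_wide _ hn) /series /= big_mkord.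
apply: cvg_near_cst; exists (size p) => // n /e.
Qed.

Lemma poly_on_disk0 : poly_on_disk 0 = fun=> 0.
Proof. by apply/funext => z; rewrite /poly_on_disk horner0 if_same. Qed.

Lemma poly_on_diskD p q : poly_on_disk (p + q) = fun z => poly_on_disk p z + poly_on_disk q z.
Proof. by apply/funext => z; rewrite /poly_on_disk; case: ifP; rewrite ?addr0// hornerD. Qed.

Lemma poly_on_diskZ c p : poly_on_disk (c *: p) = fun z => c * poly_on_disk p z.
Proof. by apply/funext => z; rewrite /poly_on_disk; case: ifP; rewrite ?mulr0// hornerZ. Qed.

Lemma poly_on_diskMX p : poly_on_disk (p * 'X) = Mz (poly_on_disk p).
Proof.
by apply/funext => z; rewrite /Mz /poly_on_disk; case: ifP; rewrite ?mulr0// hornerMX mulrC.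
Qed.

Lemma poly_on_disk_sum n (l : 'I_n -> R[i]) (P : 'I_n -> {poly R[i]}) :
  poly_on_disk (\sum_i l i *: P i) =
  \sum_i (l i : R[i]) *: (poly_on_disk (P i) : Cplx R -> Cplx R).
Proof.
elim/big_rec2: _ => [|i f q _ <-]; first exact: poly_on_disk0.
by rewrite poly_on_diskD poly_on_diskZ.
Qed.

Lemma poly_on_disk_eq0 p : poly_on_disk p = (fun=> 0) -> p = 0.
Proof.
move=> p0; have := poly_on_disk_series p; rewrite p0 => h.
by apply/polyP => n; rewrite coef0 -[LHS]/((fun n => p`_n) n) (power_series_coef_uniq h (power_series0 R)).
Qed.

(** Horner's scheme: passing from [p] to [p * 'X + c%:P] prepends the value [p.[zeta]] to the
    quotient sequence, and [c] does not enter the recursion, which reads coefficients from index 1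
    on. *)
Lemma poly_diff_seq p zeta :
  exists2 b, diff_seq (fun n => p`_n : Cplx R) zeta b & p`_0 + zeta * b 0%N = p.[zeta].
Proof.
elim/poly_ind: p => [|p c [b hb eb]].
  exists (fun=> 0); last by rewrite coef0 mulr0 addr0 horner0.
  by split=> [n|]; rewrite ?l2_norm2_0 ?ltry// mulr0 subr0 coef0.
have [h l] := diff_seq_shift_up hb; eexists; first split; [|exact: l|].
  by move=> n; rewrite h coefD coefMX coefC addr0.
by rewrite /= coefD coefMX coefC add0r eb hornerMXaddC mulrC addrC.
Qed.

Lemma poly_borelC_measurable p :
  measurable_fun (@closed_disk R : set (borelC R))
    (fun z : borelC R => (modulus (p.[z] : Cplx R) ^+ 2)%:E).
Proof.
apply/measurable_EFinP; apply: measurable_funTS; apply: continuous_borelC_measurable => z.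
have cp : continuous (fun z : Cplx R => p.[z] : Cplx R).
  rewrite (_ : (fun z => _) = (fun z => \sum_(i < size p) z ^+ i * (p`_i : Cplx R))).
    apply: continuous_big => [|j _]; first exact: add_continuous.
    by move=> w; exact: (continuousM (@complex_exprn_continuous R j w) (@cst_continuous _ _ _ w)).
  by apply/funext => w; rewrite horner_coef; apply: eq_bigr => i _; rewrite mulrC.
have h : {for z, continuous (fun z : Cplx R => modulus (p.[z] : Cplx R))}.
  exact: (@continuous_comp _ _ _ (fun z : Cplx R => p.[z] : Cplx R) (@modulus R) z
    (cp z) (@modulus_continuous R _)).
exact: (continuousM h h).
Qed.

Variable mu : {finite_measure set (borelC R) -> \bar R}.
Local Notation D := (@closed_disk R : set (borelC R)).
Local Notation DI := (dirichlet_integral mu).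
Local Notation N := (dirichlet_norm2 mu).

Lemma poly_on_disk_dirichlet p : dirichlet_space mu (poly_on_disk p).
Proof.
elim/poly_ind: p => [|p c IH]; first by rewrite poly_on_disk0; exact: dirichlet_space0.
rewrite poly_on_diskD poly_on_diskMX; apply: dirichlet_spaceD; first exact: dirichlet_space_Mz.
apply/dirichlet_spaceP; exists (fun n => c%:P`_n); first exact: poly_on_disk_series.
split.
  rewrite l2_norm2_shift [X in (_ + X)%E](_ : _ = 0%E) ?adde0 ?ltry//.
  by rewrite -[RHS](@l2_norm2_0 R); congr l2_norm2; apply/funext => n; rewrite coefC.
rewrite /dirichlet_integral integral0_eq ?ltry// => z z1.
rewrite (local_dirichlet_fin (poly_on_disk_series c%:P) z1 (b := fun=> 0)) ?l2_norm2_0//.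
by split=> [n|]; rewrite ?l2_norm2_0 ?ltry// mulr0 subr0 coefC.
Qed.

(** The defect form on the diagonal, for arbitrary [mu]: on polynomials the value that [Mz] prepends
    is [p.[z]], a continuous function of [z]. *)
Lemma dirichlet_norm2_Mz_poly p : (N (Mz (poly_on_disk p)))%:E =
  ((N (poly_on_disk p))%:E + \int[mu]_(z in D) (modulus (p.[z] : Cplx R) ^+ 2)%:E)%E.
Proof.
have Dp := poly_on_disk_dirichlet p; have hp := poly_on_disk_series p.
rewrite [LHS](dirichlet_norm2E (dirichlet_space_Mz Dp) (power_series_Mz hp)).
rewrite [X in (_ = X + _)%E](dirichlet_norm2E Dp hp).
rewrite l2_norm2_shift (_ : shift_up _ 0 = 0)// modulus0 expr0n add0e -addeA.
congr (_ + _)%E; rewrite /dirichlet_integral -ge0_integralD//.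
- apply: eq_integral => z; rewrite inE => z1.
  by have [b hb <-] := poly_diff_seq p z; rewrite (local_dirichlet_Mz hp z1 hb).
- exact: closed_disk_measurable.
- by move=> z z1; exact: local_dirichlet_ge0 hp z1.
- exact: local_dirichlet_measurable hp.
- by move=> z _; rewrite lee_fin sqr_ge0.
- exact: poly_borelC_measurable.
Qed.

(** * Measures carried by the zeros of a polynomial *)

Lemma singleton_measurable (z : borelC R) : measurable [set z].
Proof.
rewrite -[X in measurable X]setCK; apply: measurableC; apply: sub_gen_smallest.
rewrite (_ : ~` _ = (fun w : Cplx R => modulus (w - z)) @^-1` [set x | 0 < x]).
  have /continuousP : continuous (fun w : Cplx R => modulus (w - z)).
    move=> w; have cw : {for w, continuous (fun w : Cplx R => w - (z : Cplx R))}.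
      exact: (continuousB (@cvg_id _ _) (@cst_continuous _ _ (z : Cplx R) w)).
    exact: (@continuous_comp _ _ _ _ (@modulus R) w cw (@modulus_continuous R _)).
  by apply; exact: open_gt.
apply/seteqP; split=> w /=.
  by move=> /eqP wz; rewrite modulus_gt0// subr_eq0.
by move=> h wz; move: h; rewrite wz subrr modulus0 ltxx.
Qed.

Lemma poly_ae0 p : (\int[mu]_(z in D) (modulus (p.[z] : Cplx R) ^+ 2)%:E = 0)%E ->
  mu.-negligible (D `&` [set z : borelC R | p.[z] != 0]).
Proof.
move=> I0; have : (\int[mu]_(z in D) `| (modulus (p.[z] : Cplx R) ^+ 2)%:E | = 0)%E.
  by rewrite -[RHS]I0; apply: eq_integral => z _; rewrite gee0_abs// lee_fin sqr_ge0.
move=> /(ae_eq_integral_abs mu (@closed_disk_measurable R) (poly_borelC_measurable p)).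
apply: negligibleS => z /= [z1 pz] h; move/negP: pz; apply; apply/eqP; have := h z1.
by case=> /eqP; rewrite sqrf_eq0 => /eqP /modulus_eq0.
Qed.

(** Distinct points and positive masses make [k] the exact number of atoms of [mu]. *)
Definition finite_atomic (k : nat) : Prop :=
  exists (c : 'I_k -> R) (zeta : 'I_k -> borelC R),
    [/\ forall i, 0 < c i,
        forall i, @closed_disk R (zeta i),
        injective zeta
      & forall A : set (borelC R), measurable A ->
          mu A = (\sum_(i < k) (c i)%:E * \d_(zeta i) A)%E].

Lemma finite_set_measureE (s : seq (borelC R)) (A : set (borelC R)) : uniq s ->
  measurable A -> A `<=` [set` s] ->
  mu A = (\sum_(z <- s) mu [set z] * \d_z A)%E.
Proof.
elim: s A => [|x s IH] A.
  move=> _ mA sA; rewrite big_nil (_ : A = set0) ?measure0//.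
  by apply/seteqP; split=> // z /sA.
move=> /= /andP[xs us] mA sA; rewrite big_cons.
have m1 := singleton_measurable x.
rewrite (measureDI mu mA m1) [X in (X + _)%E](IH (A `\` [set x])) //; last 2 first.
- exact: measurableD.
- by move=> z [/sA]; rewrite /= inE => /predU1P[->|].
rewrite addeC; congr (_ + _)%E.
  rewrite diracE; case: (pselect (A x)) => Ax.
    by rewrite mem_set// mule1; congr (mu _); apply/seteqP; split=> [z []//|z ->].
  rewrite memNset// mule0 (_ : _ `&` _ = set0) ?measure0//.
  by apply/seteqP; split=> // z [Az zx]; apply: Ax; rewrite -zx.
rewrite big_seq [RHS]big_seq; apply: eq_bigr => z zs; congr (_ * _)%E.
rewrite !diracE; suff -> : (z \in A `\ x) = (z \in A) by [].
apply/idP/idP; rewrite !inE; first by case.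
by move=> Az; split=> // /= zx; move: xs; rewrite -zx zs.
Qed.

Lemma null_polynomial_finite_atomic p : p != 0 -> mu (~` D) = 0%E ->
  (\int[mu]_(z in D) (modulus (p.[z] : Cplx R) ^+ 2)%:E = 0)%E ->
  exists m, finite_atomic m.
Proof.
move=> p0 mu0 I0; have [r0 pE] := closed_field_poly_normal p.
have [B [mB B0 hB]] := poly_ae0 I0.
pose r : seq (borelC R) := undup r0.
have mr : measurable ([set` r] : set (borelC R)).
  elim: r {hB} => [|x s IH]; first by rewrite set_nil; exact: measurable0.
  rewrite (_ : [set` x :: s] = [set x] `|` [set` s]).
    by apply: measurableU => //; exact: singleton_measurable.
  apply/seteqP; split=> z /=; rewrite inE.
    by move=> /predU1P[->|]; [left|right].
  by move=> [->|zs]; apply/predU1P; [left|right].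
have mDc : measurable (~` D) by apply: measurableC; exact: closed_disk_measurable.
(* Off the roots, [A] is covered by the complement of the disk and by the null set [B] that contains
   the nonzeros of [p] in the disk. *)
have null A : measurable A -> mu (A `\` [set` r]) = 0%E.
  move=> mA; apply/eqP; rewrite eq_le measure_ge0 andbT.
  have : (mu ((~` D) `|` B) <= 0)%E.
    apply: le_trans (measureU2 mu mDc mB) _.
    by rewrite [X in (X + _)%E]mu0 [X in (_ + X)%E]B0 adde0.
  apply: le_trans; apply: le_measure; rewrite ?inE.
  - exact: measurableD.
  - exact: measurableU.
  - move=> z [Az nr]; have [Dz|] := pselect (D z); last by left.
    right; apply: hB; split => //=; rewrite pE hornerZ mulf_neq0 ?lead_coef_eq0//.
    apply/negP; rewrite -/(root _ _) root_prod_XsubC => zr; apply: nr.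
    by rewrite /= mem_undup.
(* Dropping the roots of measure zero makes the masses positive, and with them go all roots outside
   the closed disk. *)
pose s := [seq z <- r | (0 < mu [set z])%E].
pose Z (i : 'I_(size s)) := tnth (in_tuple s) i.
exists (size s), (fun i => fine (mu [set Z i])), Z; split.
- move=> i; have := mem_tnth i (in_tuple s); rewrite -/(Z i) mem_filter => /andP[h _].
  apply: fine_gt0; rewrite h /= -ge0_fin_numE ?measure_ge0//.
  by apply: fin_num_measure; exact: singleton_measurable.
- move=> i; have := mem_tnth i (in_tuple s); rewrite -/(Z i) mem_filter => /andP[h _].
  apply: contrapT => nD; move: h; apply/negP; rewrite -leNgt -[leRHS]mu0.
  by apply: le_measure; rewrite ?inE//; [exact: singleton_measurable|move=> z ->].
- by apply/tuple_uniqP; rewrite /= filter_uniq// undup_uniq.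
- move=> A mA; rewrite (measureDI mu mA mr) [X in (X + _)%E]null// add0e.
  rewrite [LHS](finite_set_measureE (undup_uniq r0) (measurableI _ _ mA mr)); last by move=> z [].
  transitivity (\sum_(z <- s) (fine (mu [set z]))%:E * \d_z A)%E; last first.
    by rewrite big_tnth.
  rewrite big_filter [RHS]big_mkcond /= big_seq [RHS]big_seq.
  apply: eq_bigr => z zr; case: ifPn => [h|].
    rewrite fineK; last by apply: fin_num_measure; exact: singleton_measurable.
    congr (_ * _)%E; rewrite !diracE.
    suff -> : (z \in A `&` [set` r]) = (z \in A) by [].
    by apply/idP/idP; rewrite !inE; [case|split].
  rewrite -leNgt => h.
  by rewrite (_ : mu [set z] = 0%E) ?mul0e//; apply/eqP; rewrite eq_le h measure_ge0.
Qed.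

End PolynomialFunctions.

(** * Finite rank forces finite support *)

Section RankFinite.
Variables (R : realType) (mu : {finite_measure set (borelC R) -> \bar R}).
Implicit Types (f g : Cplx R -> Cplx R).
Local Notation D := (@closed_disk R : set (borelC R)).
Local Notation N := (dirichlet_norm2 mu).

(** The coefficient matrix of [F] in terms of [e] has more rows than columns, so its left kernel is
    nonzero. *)
Lemma lin_comb_dependent n k (e : 'I_k -> Cplx R -> Cplx R) (F : 'I_n -> Cplx R -> Cplx R) :
  (k < n)%N -> (forall j, range (lin_comb e) (F j)) ->
  exists2 l : 'I_n -> R[i], (exists j, l j != 0) &
    (\sum_j (l j : R[i]) *: F j) = fun=> 0.
Proof.
move=> kn hF; have /choice[c cE] j : exists c, lin_comb e c = F j.
  by have [c _ hc] := hF j; exists c.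
pose C := \matrix_(j < n, i < k) (c j i : R[i]).
have : kermx C != 0.
  rewrite -mxrank_eq0 mxrank_ker -lt0n subn_gt0.
  exact: leq_ltn_trans (rank_leq_col C) kn.
move=> /rowV0Pn[v /sub_kermxP vC v0].
exists (fun j => v 0 j).
  apply: contrapT => /forallNP h; move/negP: v0; apply; apply/eqP/rowP => j.
  by rewrite mxE; apply: contrapT => /eqP /h.
apply/funext => z; rewrite fct_sumE.
transitivity (\sum_(i < k) (v *m C) 0 i * e i z); last first.
  by rewrite vC big1// => i _; rewrite mxE mul0r.
transitivity (\sum_j v 0 j * \sum_(i < k) c j i * e i z).
  by apply: eq_bigr => j _; rewrite -cE.
under eq_bigr do rewrite mulr_sumr.
rewrite exchange_big /=; apply: eq_bigr => i _.
rewrite mxE mulr_suml; apply: eq_bigr => j _.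
by rewrite mxE mulrA.
Qed.

Lemma has_rank_finite_atomic k : mu (~` D) = 0%E ->
  has_rank (dirichlet_space mu) (defect mu) k -> exists m, finite_atomic mu m.
Proof.
move=> mu0 [e [_ eE]]; pose F (j : 'I_k.+1) := defect mu (poly_on_disk ('X^j)).
have [||l [j0 lj0] hl] := @lin_comb_dependent k.+1 k e F; first exact: ltnSn.
  move=> j; rewrite -eE; exists (poly_on_disk 'X^j) => //.
  exact: poly_on_disk_dirichlet.
pose p : {poly R[i]} := \sum_j l j *: 'X^j.
have p0 : p != 0.
  apply: contra_neq lj0 => p0; have := coef0 R[i] j0; rewrite -p0 /p coef_sum.
  rewrite (bigD1 j0)//= coefZ coefXn eqxx mulr1 big1 ?addr0// => j jj0.
  by rewrite coefZ coefXn eq_sym (inj_eq val_inj) (negPf jj0) mulr0.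
pose S := adjoint mu (@Mz R).
(* The linear relation among the defects of the monomials. It is kept as a sum of values of [S],
   which is only a chosen function and not known to be linear. *)
have hS : \sum_j (l j : R[i]) *: S (Mz (poly_on_disk 'X^j)) = poly_on_disk p.
  rewrite poly_on_disk_sum; apply/eqP; rewrite -subr_eq0 -sumrB; apply/eqP.
  by rewrite -[RHS]hl; apply: eq_bigr => j _; rewrite -scalerBr.
(* Without an adjoint, [defect] is [- id], which is injective on polynomials. *)
have [hadj|nadj] := pselect (exists S, is_adjoint mu (@Mz R) S); last first.
  case/negP : p0; apply/eqP/poly_on_disk_eq0; rewrite -hS.
  rewrite big1// => j _; rewrite /S /adjoint xgetPN ?scaler0//.
  by move=> T hT; apply: nadj; exists T.
have [SD Sadj] : is_adjoint mu (@Mz R) S by exact: (xgetPex _ hadj).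
have Q := dirichlet_quad_norm mu.
have Dp q : dirichlet_space mu (poly_on_disk q) by exact: poly_on_disk_dirichlet.
have DM q : dirichlet_space mu (Mz (poly_on_disk q)) by exact: dirichlet_space_Mz.
apply: null_polynomial_finite_atomic p0 mu0 _.
have := dirichlet_norm2_Mz_poly mu p.
(* Pairing [p] with [hS] and moving [S] across term by term turns the inner product of [p] with
   itself into that of [Mz p] with itself. The common value being finite, the integral vanishes. *)
suff -> : N (Mz (poly_on_disk p)) = N (poly_on_disk p).
  case: (\int[mu]_(z in D) _)%E => [r []|//|//].
  by move/eqP; rewrite -[eqbLHS]addr0 (inj_eq (addrI _)) eq_sym => /eqP ->.
apply: (@complexI R); rewrite -[LHS](polar_form_diag Q (DM p)) -[RHS](polar_form_diag Q (Dp p)).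
have hSS := (polar_form_sumr Q l (Dp p) (fun j => SD _ (DM 'X^j))).2.
rewrite hS in hSS; rewrite [RHS]hSS.
have hM : Mz (poly_on_disk p) = \sum_j (l j : R[i]) *: Mz (poly_on_disk 'X^j).
  rewrite -poly_on_diskMX /p mulr_suml.
  under eq_bigr do rewrite -scalerAl.
  rewrite poly_on_disk_sum; apply: eq_bigr => j _.
  by rewrite poly_on_diskMX.
have PM j : dirichlet_space mu (Mz (poly_on_disk 'X^(j : 'I_k.+1))) by exact: DM.
have hMM : polar_form N (Mz (poly_on_disk p)) (Mz (poly_on_disk p)) =
    \sum_j (l j)^* * polar_form N (Mz (poly_on_disk p)) (Mz (poly_on_disk 'X^j)).
  by have := (polar_form_sumr Q l (DM p) PM).2; rewrite -hM.
apply: (eq_trans hMM); apply: eq_bigr => j _.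
exact: (congr1 (fun w => (l j)^* * w) (Sadj _ _ (Dp p) (PM j))).
Qed.
End RankFinite.

(** * Finitely supported measures *)

Section FiniteAtomic.
Variables (R : realType) (mu : {finite_measure set (borelC R) -> \bar R}).
Variables (m : nat) (c : 'I_m -> R) (zeta : 'I_m -> borelC R).
Hypotheses (c_gt0 : forall i, 0 < c i) (zeta_disk : forall i, @closed_disk R (zeta i)).
Hypothesis zeta_inj : injective zeta.
Hypothesis muE : forall A : set (borelC R), measurable A ->
  mu A = (\sum_(i < m) (c i)%:E * \d_(zeta i) A)%E.
Implicit Types (f g : Cplx R -> Cplx R) (a b : nat -> Cplx R).
Local Notation D := (@closed_disk R : set (borelC R)).
Local Notation DI := (dirichlet_integral mu).
Local Notation N := (dirichlet_norm2 mu).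

Lemma atomic_integralE (phi : borelC R -> \bar R) : measurable_fun D phi ->
  (forall z, D z -> (0 <= phi z)%E) ->
  (\int[mu]_(z in D) phi z = \sum_(i < m) (c i)%:E * phi (zeta i))%E.
Proof.
move=> mphi phi0; have mD := @closed_disk_measurable R.
(* [msum] takes measures indexed by [nat]; beyond the [m] atoms they are zero. *)
pose nu n : {measure set (borelC R) -> \bar R} :=
  if insub n is Some i then mscale (NngNum (ltW (c_gt0 i))) (\d_(zeta i) : {measure set (borelC R) -> \bar R}) else mzero.
have nuE (i : 'I_m) : nu i = mscale (NngNum (ltW (c_gt0 i))) (\d_(zeta i) : {measure set (borelC R) -> \bar R}).
  by rewrite /nu valK.
rewrite (eq_measure_integral (msum nu m)); last first.
  move=> A mA _; transitivity (\sum_(n < m) nu n A)%E => //.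
  by rewrite [LHS]muE//; apply: eq_bigr => i _; rewrite nuE.
rewrite ge0_integral_measure_sum//; apply: eq_bigr => i _.
rewrite nuE ge0_integral_mscale// integral_dirac// diracE mem_set ?mul1e//.
Qed.

Lemma atomic_dirichlet_integralE f a : power_series_on_disk f a ->
  DI f = (\sum_(i < m) (c i)%:E * local_dirichlet f (zeta i))%E.
Proof.
move=> fa; rewrite /dirichlet_integral atomic_integralE//.
- exact: local_dirichlet_measurable fa.
- by move=> z; exact: local_dirichlet_ge0 fa.
Qed.

Lemma atomic_dirichlet_spaceP f a : power_series_on_disk f a -> (l2_norm2 a < +oo)%E ->
  dirichlet_space mu f <-> forall i, exists b, diff_seq a (zeta i) b.
Proof.
move=> fa la; split.
  move=> /dirichlet_spaceP[_ _ [_]]; rewrite (atomic_dirichlet_integralE fa) => h i.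
  have [//|b hb _] := local_dirichlet_lty fa (zeta_disk i); last by exists b.
  have pos j : (0 <= (c j)%:E * local_dirichlet f (zeta j))%E.
    by apply: mule_ge0; [rewrite lee_fin ltW|exact: local_dirichlet_ge0 fa (zeta_disk j)].
  have : ((c i)%:E * local_dirichlet f (zeta i) < +oo)%E.
    by apply: le_lt_trans h; rewrite (bigD1 i)//= leeDl// sume_ge0.
  rewrite !ltey; apply: contra_neq => ->.
  by rewrite gt0_muley// lte_fin.
move=> h; apply/dirichlet_spaceP; exists a => //; split=> //.
rewrite (atomic_dirichlet_integralE fa); apply: lte_sum_pinfty => i _.
have [b hb] := h i; rewrite (local_dirichlet_fin fa (zeta_disk i) hb).
by apply: lte_mul_pinfty; rewrite ?lee_fin ?(ltW (c_gt0 i))//; exact: hb.2.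
Qed.

Lemma atomic_dirichlet_norm2E f a (b : 'I_m -> nat -> Cplx R) :
  power_series_on_disk f a -> (l2_norm2 a < +oo)%E -> (forall i, diff_seq a (zeta i) (b i)) ->
  (N f)%:E = (l2_norm2 a + \sum_(i < m) (c i)%:E * l2_norm2 (b i))%E.
Proof.
move=> fa la hb; rewrite (dirichlet_norm2E _ fa); last first.
  by apply/(atomic_dirichlet_spaceP fa la) => i; exists (b i).
rewrite (atomic_dirichlet_integralE fa); congr (_ + _)%E; apply: eq_bigr => i _.
by rewrite (local_dirichlet_fin fa (zeta_disk i) (hb i)).
Qed.

(** Chosen coefficients, so that boundary values become functions of [f]; on the Dirichlet space
    [atomic_seqs] shows that the default never occurs. *)
Definition taylor f : nat -> Cplx R := xget (fun=> 0) [set a | power_series_on_disk f a].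

Definition taylor_quotient f i : nat -> Cplx R :=
  xget (fun=> 0) [set b | diff_seq (taylor f) (zeta i) b].

(** For [f] in the space, the value at [zeta i] in the open disk and the nontangential limit on the
    circle, where [f] itself is 0 by the convention on representatives. *)
Definition boundary_value f i : Cplx R := taylor f 0%N + zeta i * taylor_quotient f i 0%N.

Lemma taylorE f a : power_series_on_disk f a -> taylor f = a.
Proof.
move=> fa; apply: (power_series_coef_uniq _ fa); rewrite /taylor.
exact: (@xgetPex _ _ [set a | power_series_on_disk f a] (ex_intro _ a fa)).
Qed.

Lemma taylor_quotientE f a i b : power_series_on_disk f a -> diff_seq a (zeta i) b ->
  taylor_quotient f i = b.
Proof.
move=> fa hb; apply: (diff_seq_uniq (zeta_disk i) _ hb); rewrite /taylor_quotient (taylorE fa).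
exact: (@xgetPex _ _ [set b | diff_seq a (zeta i) b] (ex_intro _ b hb)).
Qed.

Lemma boundary_valueE f a i b : power_series_on_disk f a -> diff_seq a (zeta i) b ->
  boundary_value f i = a 0%N + zeta i * b 0%N.
Proof. by move=> fa hb; rewrite /boundary_value (taylorE fa) (taylor_quotientE fa hb). Qed.

Lemma atomic_seqs f : dirichlet_space mu f ->
  [/\ power_series_on_disk f (taylor f), (l2_norm2 (taylor f) < +oo)%E &
      forall i, diff_seq (taylor f) (zeta i) (taylor_quotient f i)].
Proof.
move=> /[dup] Df /dirichlet_spaceP[a fa [la _]]; rewrite (taylorE fa); split=> // i.
have [b hb] := (atomic_dirichlet_spaceP fa la).1 Df i.
by rewrite (taylor_quotientE fa hb).
Qed.

Lemma boundary_valueD f g i : dirichlet_space mu f -> dirichlet_space mu g ->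
  boundary_value (fun z => f z + g z) i = boundary_value f i + boundary_value g i.
Proof.
move=> /atomic_seqs[fa _ /(_ i) hf] /atomic_seqs[ga _ /(_ i) hg].
rewrite (boundary_valueE (power_seriesD fa ga) (diff_seqD hf hg)) /boundary_value.
by ring.
Qed.

Lemma boundary_valueZ (x : Cplx R) f i : dirichlet_space mu f ->
  boundary_value (fun z => x * f z) i = x * boundary_value f i.
Proof.
move=> /atomic_seqs[fa _ /(_ i) hf].
rewrite (boundary_valueE (power_seriesZ x fa) (diff_seqZ x hf)) /boundary_value.
by ring.
Qed.

Lemma boundary_value_poly (p : {poly R[i]}) i : boundary_value (poly_on_disk p) i = p.[zeta i].
Proof.
by have [b hb <-] := poly_diff_seq p (zeta i); rewrite (boundary_valueE (poly_on_disk_series p) hb).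
Qed.

Lemma atomic_norm2_Mz f : dirichlet_space mu f ->
  N (Mz f) = N f + \sum_(i < m) c i * modulus (boundary_value f i) ^+ 2.
Proof.
move=> /atomic_seqs[fa la hf]; apply: EFin_inj.
rewrite (atomic_dirichlet_norm2E (power_series_Mz fa) _ (fun i => diff_seq_shift_up (hf i))).
  rewrite EFinD (atomic_dirichlet_norm2E fa la hf) -addeA; congr (_ + _)%E.
    by rewrite l2_norm2_shift (_ : shift_up _ 0 = 0)// modulus0 expr0n add0e.
  rewrite -sumEFin -big_split /=; apply: eq_bigr => i _.
  rewrite l2_norm2_shift /= ge0_muleDr ?l2_norm2_ge0// ?lee_fin ?sqr_ge0//.
  by rewrite addeC EFinM.
by rewrite l2_norm2_shift (_ : shift_up _ 0 = 0)// modulus0 expr0n add0e.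
Qed.

(** Taylor coefficients and quotient sequences embed the space in a finite weighted sum of copies of
    l^2. The image is closed because the recursion tying [b] to [a] involves finitely many
    coordinates at a time and so survives coordinatewise limits. *)
Lemma atomic_complete (u : nat -> Cplx R -> Cplx R) : (forall n, dirichlet_space mu (u n)) ->
  (forall n k, N (u n - u k) <= n.+1%:R^-1 + k.+1%:R^-1) ->
  exists2 y, dirichlet_space mu y & exists K : R, forall n, N (u n - y) <= K * n.+1%:R^-1.
Proof.
move=> Du hu.
pose A n := taylor (u n); pose B i n := taylor_quotient (u n) i.
have hA n : power_series_on_disk (u n) (A n) by case: (atomic_seqs (Du n)).
have lA n : (l2_norm2 (A n) < +oo)%E by case: (atomic_seqs (Du n)).
have hB n i : diff_seq (A n) (zeta i) (B i n) by case: (atomic_seqs (Du n)).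
have psB f g a a' : power_series_on_disk f a -> power_series_on_disk g a' ->
    power_series_on_disk (f - g) (fun n => a n - a' n).
  move=> fa ga; have := power_seriesD fa (power_seriesZ (-1) ga).
  rewrite (_ : (fun z => f z + -1 * g z) = f - g); last by apply/funext => z; rewrite mulN1r.
  by under [X in power_series_on_disk _ X]eq_fun do rewrite mulN1r.
have l2B a a' : (l2_norm2 a < +oo)%E -> (l2_norm2 a' < +oo)%E ->
    (l2_norm2 (fun n => a n - a' n)%R < +oo)%E.
  move=> la la'; have := l2_norm2D_fin la (l2_norm2Z_fin (-1) la').
  by under [X in l2_norm2 X]eq_fun do rewrite mulN1r.
have NE n k := atomic_dirichlet_norm2E (psB _ _ _ _ (hA n) (hA k)) (l2B _ _ (lA n) (lA k))
  (fun i => diff_seqB (hB n i) (hB k i)).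
have pos (i : 'I_m) (x : nat -> Cplx R) : (0 <= (c i)%:E * l2_norm2 x)%E.
  by rewrite mule_ge0 ?l2_norm2_ge0// lee_fin ltW.
have [|a [ca ha]] := @l2_complete R A 1 ltr01.
  move=> n k; rewrite mul1r; have := hu n k; rewrite -lee_fin NE; apply: le_trans.
  by rewrite leeDl// sume_ge0.
have /choice[b hb] i : exists b, (forall j, (B i) ^~ j @ \oo --> b j) /\
    forall n, (l2_norm2 (fun j => B i n j - b j)%R <= ((c i)^-1 * n.+1%:R^-1)%:E)%E.
  apply: l2_complete; first by rewrite invr_gt0.
  move=> n k; have := hu n k; rewrite -lee_fin NE => h.
  rewrite mulrC EFinM lee_pdivlMr// muleC; apply: le_trans h.
  by rewrite addeC (bigD1 i)//= -addeA leeDl// adde_ge0 ?l2_norm2_ge0 ?sume_ge0.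
have lfin x y (e : R) : (l2_norm2 x < +oo)%E -> (l2_norm2 (fun j => x j - y j)%R <= e%:E)%E ->
    (l2_norm2 y < +oo)%E.
  move=> lx h; have := l2B _ _ lx (le_lt_trans h (ltry _)).
  by under [X in l2_norm2 X]eq_fun do rewrite subKr.
have la := lfin _ _ _ (lA 0%N) (ha 0%N).
have hab i : diff_seq a (zeta i) (b i).
  have [cb hbn] := hb i; split; last exact: lfin (hB 0%N i).2 (hbn 0%N).
  move=> j; apply: (cvg_uniq _ (ca j.+1)).
  rewrite (_ : A ^~ j.+1 = (fun n => B i n j - zeta i * B i n j.+1)).
    by apply: cvgB; [exact: cb|apply: cvgMl_tmp; exact: cb].
  by apply/funext => n; case: (hB n i) => + _; move=> /(_ j).
have [f fa] := power_series_exists la.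
exists f; first by apply/(atomic_dirichlet_spaceP fa la) => i; exists (b i).
(* The Taylor coefficients contribute 1; each atom contributes [c i] times the constant [(c i)^-1]
   of its quotient sequences, again 1. *)
exists (1 + m%:R) => n; rewrite -lee_fin.
rewrite (atomic_dirichlet_norm2E (psB _ _ _ _ (hA n) fa) (l2B _ _ (lA n) la)
  (fun i => diff_seqB (hB n i) (hab i))).
rewrite mulrDl EFinD; apply: leeD; first exact: ha.
apply: (@le_trans _ _ (\sum_(i < m) (n.+1%:R^-1)%:E)%E).
  apply: lee_sum => i _; rewrite -lee_pdivlMl//.
  by rewrite -EFinM; exact: (hb i).2.
by rewrite sumEFin sumr_const card_ord mulr_natl.
Qed.

Lemma polarization (x y : R[i]) :
  4^-1 * \sum_(j < 4) 'i ^+ j * (modulus (x + 'i ^+ j * y : Cplx R) ^+ 2)%:C%C = x * y^*.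
Proof.
under eq_bigr do rewrite sqr_modulus_conj rmorphD rmorphM rmorphXn /= conjCi.
rewrite !big_ord_recl big_ord0 addr0 /= /bump /= ?add1n ?addn0 ?add1n.
have h : ('i : R[i]) ^+ 2 = -1 by exact: sqrCi.
have h3 : ('i : R[i]) ^+ 3 = - 'i by rewrite exprS h mulrN1.
have h3' : (- 'i : R[i]) ^+ 3 = 'i by rewrite exprNn h3 mulrN -signr_odd /= expr1 mulN1r opprK.
rewrite !expr0 !expr1 h3 h3' sqrrN h !mul1r !mulN1r.
apply/eqP; rewrite -subr_eq0; apply/eqP.
(* Again a multiple of [1 + 'i ^+ 2], out of reach of [ring] alone. *)
transitivity (4^-1 * (2 * (1 + 'i ^+ 2) * (y * x^* - x * y^*))); first by field.
by rewrite h subrr mulr0 mul0r mulr0.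
Qed.

Lemma atomic_inner_Mz f g : dirichlet_space mu f -> dirichlet_space mu g ->
  dirichlet_inner mu (Mz f) (Mz g) = dirichlet_inner mu f g +
  \sum_(i < m) (c i)%:C%C * (boundary_value f i * (boundary_value g i)^*).
Proof.
move=> Df Dg; rewrite /dirichlet_inner.
transitivity (4^-1 * \sum_(j < 4) 'i ^+ j * ((dirichlet_norm2 mu (fun z => f z + 'i ^+ j * g z))%:C%C
    + \sum_(i < m) (c i)%:C%C * (modulus (boundary_value f i + 'i ^+ j * boundary_value g i) ^+ 2)%:C%C)).
  congr (_ * _); apply: eq_bigr => j _; congr (_ * _).
  rewrite (_ : (fun z => Mz f z + _) = Mz (fun z => f z + 'i ^+ j * g z)); last first.
    by apply/funext => z; rewrite /Mz mulrDr mulrCA.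
  have Dig := dirichlet_spaceZ ('i ^+ j) Dg.
  rewrite (atomic_norm2_Mz (dirichlet_spaceD Df Dig)) rmorphD rmorph_sum /=.
  congr (_ + _); apply: eq_bigr => i _.
  by rewrite boundary_valueD// boundary_valueZ// rmorphM.
under eq_bigr do rewrite mulrDr.
rewrite big_split mulrDr /=; congr (_ + _).
under eq_bigr do rewrite mulr_sumr.
rewrite exchange_big mulr_sumr /=; apply: eq_bigr => i _.
rewrite -polarization [RHS]mulrCA; congr (_ * _); rewrite mulr_sumr; apply: eq_bigr => j _.
by rewrite mulrCA.
Qed.

(** Riesz representation is applied to the real functional [f |-> real_form N (Mz f) g]. The
    imaginary part follows because [Mz] commutes with multiplication by ['i]. *)
Lemma atomic_adjoint : exists S, is_adjoint mu (@Mz R) S.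
Proof.
have Q := dirichlet_quad_norm mu.
have DM f : dirichlet_space mu f -> dirichlet_space mu (Mz f) by exact: dirichlet_space_Mz.
have DZ (x : R[i]) (f : Cplx R -> Cplx R) : dirichlet_space mu f -> dirichlet_space mu (x *: f).
  exact: dirichlet_spaceZ.
have MZ (x : R[i]) (f : Cplx R -> Cplx R) : Mz (x *: f) = x *: Mz f.
  by apply/funext => z; rewrite /Mz /= mulrCA.
have MD (f h : Cplx R -> Cplx R) : Mz (f + h) = Mz f + Mz h.
  by apply/funext => z; exact: mulrDr.
have /choice[S hS] g : exists y, dirichlet_space mu g -> dirichlet_space mu y /\
    forall f, dirichlet_space mu f -> real_form N (Mz f) g = real_form N f y.
  have [Dg|nDg] := pselect (dirichlet_space mu g); last by exists g.
  pose C := 3 + 2 * fine (mu D).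
  have C1 : 1 <= C by have : 0 <= fine (mu D) by [exact: fine_ge0]; rewrite /C; lra.
  have C0 : 0 < C by exact: lt_le_trans C1.
  have [|||y Dy hy] := @riesz_real R (Cplx R -> Cplx R) _ _ Q atomic_complete
    (fun f => real_form N (Mz f) g) (C ^+ 2 * N g).
  - by move=> f h Df Dh; rewrite MD (real_formDl Q (DM _ Df) (DM _ Dh) Dg).
  - by move=> t f Df; rewrite (MZ t%:C%C f) (real_formZl Q t (DM _ Df) Dg).
  (* The pairing of [Mz f] with [g] equals that of [C^-1 *: Mz f] with [C *: g]; since
     [N (Mz f) <= C * N f] and [C >= 1], the first factor contributes at most [N f], the second
     [C ^+ 2 * N g]. *)
  - move=> f Df; have Mf := DM _ Df.
    have := two_real_form_le Q (DZ (C^-1)%:C%C _ Mf) (DZ C%:C%C _ Dg).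
    rewrite (real_formZl Q _ Mf (DZ _ _ Dg)) (real_formC Q Mf (DZ _ _ Dg)).
    rewrite (real_formZl Q _ Dg Mf) mulKf ?gt_eqF// (real_formC Q Dg Mf).
    have [_ _ NZ _] := Q; rewrite (NZ _ _ Mf) (NZ _ _ Dg) !modulus_real ![in `|_|]gtr0_norm ?invr_gt0//.
    move=> h; apply: le_trans h _; rewrite lerD2r.
    apply: le_trans (ler_wpM2l _ (dirichlet_norm2_Mz_le Df)) _; first exact: sqr_ge0.
    rewrite -/C expr2 -mulrA mulKf ?gt_eqF// ler_piMl//; last by rewrite invf_le1.
    by have [_ + _ _] := Q; apply.
  - by exists y => _; split; [exact: Dy|exact: hy].
exists S; split=> [f Df|f g Df Dg]; first by case: (hS f Df).
have [DS h] := hS g Dg.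
rewrite !dirichlet_innerE !polar_formE (h _ Df).
(* Skewness moves ['i] to the first argument on both sides, and the real identity is used at
   ['i *: f]. *)
suff -> : real_form N (Mz f) ('i *: g) = real_form N f ('i *: S g) by [].
apply: oppr_inj; rewrite -[LHS](real_form_il Q (DM _ Df) Dg) -[RHS](real_form_il Q Df DS).
by rewrite -(MZ 'i f); exact: h _ (DZ 'i _ Df).
Qed.

Lemma dirichlet_inner_eq0 h : dirichlet_space mu h ->
  (forall g, dirichlet_space mu g -> dirichlet_inner mu g h = 0) -> h = fun=> 0.
Proof.
move=> Dh h0; apply: (dirichlet_norm2_eq0 Dh); apply: (@complexI R).
by rewrite -(polar_form_diag (dirichlet_quad_norm mu) Dh) -dirichlet_innerE h0.
Qed.

Definition lagrange (i : 'I_m) : {poly R[i]} :=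
  \prod_(j < m | j != i) ((zeta i - zeta j : R[i])^-1 *: ('X - (zeta j : R[i])%:P)).

Lemma lagrangeE i j : (lagrange i).[zeta j] = (i == j)%:R.
Proof.
rewrite /lagrange horner_prod; case: eqVneq => [<-|ij].
  rewrite big1// => k ki; rewrite hornerZ hornerXsubC mulVf//.
  by rewrite subr_eq0 (inj_eq zeta_inj) eq_sym.
rewrite (bigD1 j)/=; last by rewrite eq_sym.
by rewrite hornerZ hornerXsubC subrr mulr0 mul0r.
Qed.

Lemma atomic_has_rank : has_rank (dirichlet_space mu) (defect mu) m.
Proof.
have Q := dirichlet_quad_norm mu.
pose S := adjoint mu (@Mz R).
have [SD Sadj] : is_adjoint mu (@Mz R) S by exact: (xgetPex _ atomic_adjoint).
have DM f : dirichlet_space mu f -> dirichlet_space mu (Mz f) by exact: dirichlet_space_Mz.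
have DS f : dirichlet_space mu f -> dirichlet_space mu (S (Mz f)).
  by move=> Df; exact: SD (DM _ Df).
have defectE f : defect mu f = S (Mz f) - f by [].
have [[_ DD DZ] _ _ _] := Q.
have DT f : dirichlet_space mu f -> dirichlet_space mu (defect mu f).
  move=> Df; rewrite defectE -scaleN1r; exact: DD (DS _ Df) (DZ (-1) _ Df).
have innerT g f : dirichlet_space mu g -> dirichlet_space mu f ->
    dirichlet_inner mu g (defect mu f) =
    \sum_(i < m) (c i)%:C%C * (boundary_value g i * (boundary_value f i)^*).
  move=> Dg Df; rewrite defectE dirichlet_innerE (polar_formBr Q (DS _ Df) Df Dg).
  rewrite -!dirichlet_innerE -(Sadj _ _ Dg (DM _ Df)) atomic_inner_Mz//.
  by rewrite addrC addKr.
have DL (p : {poly R[i]}) : dirichlet_space mu (poly_on_disk p) by exact: poly_on_disk_dirichlet.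
(* Obtaining the kernels as defects of Lagrange polynomials settles their existence and puts them in
   the range at once. *)
pose e i := defect mu (poly_on_disk (lagrange i)).
have innere g i : dirichlet_space mu g ->
    dirichlet_inner mu g (e i) = (c i)%:C%C * boundary_value g i.
  move=> Dg; rewrite (innerT _ _ Dg (DL _)) (bigD1 i)//= big1 => [|j ji].
    by rewrite boundary_value_poly lagrangeE eqxx rmorph1 mulr1 addr0.
  by rewrite boundary_value_poly lagrangeE eq_sym (negPf ji) rmorph0 !mulr0.
have De i : dirichlet_space mu (e i) by exact: DT.
have lcE x : lin_comb e x = \sum_i (x i : R[i]) *: e i.
  by apply/funext => z; rewrite fct_sumE.
have inner_lc g x : dirichlet_space mu g -> dirichlet_space mu (lin_comb e x) /\
    dirichlet_inner mu g (lin_comb e x) =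
    \sum_(i < m) (c i)%:C%C * (boundary_value g i * (x i)^*).
  move=> Dg; rewrite lcE dirichlet_innerE.
  have [h1 ->] := polar_form_sumr Q x Dg De; split=> //; apply: eq_bigr => i _.
  by rewrite -dirichlet_innerE innere// mulrCA mulrC -mulrA mulrC -mulrA mulrCA.
(* Both sides have the same inner product with every [g] in the space, and the norm is definite. *)
have Te f : dirichlet_space mu f -> defect mu f = lin_comb e (boundary_value f).
  move=> Df; apply/eqP; rewrite -subr_eq0; apply/eqP.
  have [Dl _] := inner_lc f (boundary_value f) Df.
  apply: dirichlet_inner_eq0.
    by rewrite -scaleN1r; exact: DD (DT _ Df) (DZ (-1) _ Dl).
  move=> g Dg; rewrite dirichlet_innerE (polar_formBr Q (DT _ Df) Dl Dg).
  by rewrite -!dirichlet_innerE (innerT _ _ Dg Df) (inner_lc g _ Dg).2 subrr.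
exists e; split.
  (* Pairing with the [i]-th Lagrange polynomial isolates [c i] times the conjugate of [x i]. *)
  move=> x x0 i; have Di := DL (lagrange i).
  have [_] := inner_lc _ x Di; rewrite x0 dirichlet_innerE (polar_form0r Q Di).
  rewrite (bigD1 i)//= big1 => [|j ji]; last first.
    by rewrite boundary_value_poly lagrangeE eq_sym (negPf ji) mul0r mulr0.
  rewrite addr0 boundary_value_poly lagrangeE eqxx mul1r => /esym/eqP.
  rewrite mulf_eq0 conjC_eq0 => /orP[/eqP ci|/eqP //].
  have := c_gt0 i; suff -> : c i = 0 by rewrite ltxx.
  by case: ci.
apply/seteqP; split=> [_ [f Df <-]|_ [x _ <-]].
  by exists (boundary_value f) => //; rewrite Te.
(* The interpolating polynomial with value [x i] at [zeta i]. *)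
exists (poly_on_disk (\sum_i (x i : R[i]) *: lagrange i)); first exact: DL.
rewrite Te//; congr lin_comb; apply/funext => i.
rewrite boundary_value_poly horner_sum (bigD1 i)//= big1 => [|j ji].
  by rewrite hornerZ lagrangeE eqxx mulr1 addr0.
by rewrite hornerZ lagrangeE (negPf ji) mulr0.
Qed.

End FiniteAtomic.

(** * Invariance of dimension and the equivalence *)

Lemma has_dim_le (R : realType) (V : set (Cplx R -> Cplx R)) m k :
  has_dim V m -> has_dim V k -> (m <= k)%N.
Proof.
move=> [e [ie eE]] [d [_ dE]]; rewrite leqNgt; apply/negP => km.
have [j|l [j lj] hl] := @lin_comb_dependent R m k d e km.
  rewrite -dE eE; exists (fun i => (i == j)%:R) => //; apply/funext => z.
  rewrite /lin_comb (bigD1 j)//= eqxx mul1r big1 ?addr0// => i /negPf ->.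
  by rewrite mul0r.
move/negP: lj; apply; apply/eqP/ie; rewrite -hl.
by apply/funext => z; rewrite fct_sumE.
Qed.

Theorem proposition2p1 (R : realType)
    (mu : {finite_measure set (borelC R) -> \bar R})
    (mu_supp : mu (~` @closed_disk R) = 0%E)
    (k : nat) (k_gt0 : (0 < k)%N) :
  has_rank (dirichlet_space mu) (defect mu) k <->
  exists (c : 'I_k -> R) (zeta : 'I_k -> borelC R),
    [/\ forall i, 0 < c i,
        forall i, @closed_disk R (zeta i),
        injective zeta
      & forall A : set (borelC R), measurable A ->
          mu A = (\sum_(i < k) (c i)%:E * \d_(zeta i) A)%E].
Proof.
split=> [hk|[c [zeta [c0 z1 zi muE]]]]; last exact: atomic_has_rank c0 z1 zi muE.
have [m hm] := has_rank_finite_atomic mu_supp hk.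
(* With [m] distinct atoms the converse gives rank [m], and the same image cannot have two
   dimensions. *)
suff -> : k = m by [].
have [c [zeta [c0 z1 zi muE]]] := hm.
have hm' := atomic_has_rank c0 z1 zi muE.
by apply/eqP; rewrite eqn_leq (has_dim_le hk hm') (has_dim_le hm' hk).
Qed.
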